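(* Let $0<\alpha_2<\alpha_1<1$, $\lambda>0$, $C_1\ge0$, $C_2\ge0$ with $C_1+C_2=1$, and $c>0$. For $u>0$ let $$\bar R^{\alpha_1,\alpha_2}(t)=u+ct-\sum_{i=1}^{N^{\alpha_1,\alpha_2}(t)}X_i,\quad t\ge0,$$ where the $X_i$ are iid positive random variables, independent of the mixed fractional Poisson process $\{N^{\alpha_1,\alpha_2}(t)\}_{t\ge0}$, whose common distribution is subexponential. Then for each fixed $t>0$, the ruin probability in finite time satisfies, as $u\to\infty$, $$\mathrm{Pr}\left\{\bar R^{\alpha_1,\alpha_2}(t^* )<0\ \text{for some}\ t^*\le t\right\}\sim\lambda\, U_{\alpha_1,\alpha_2}(t)\,\bar F_{X_1}(u),$$ where $U_{\alpha_1,\alpha_2}(t)=\mathbb{E}(Y_{\alpha_1,\alpha_2}(t))$ and $\bar F_{X_1}(u)=\mathrm{Pr}\{X_1>u\}$.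
   Context: The mixed stable subordinator $\{D_{\alpha_1,\alpha_2}(t)\}_{t\ge0}$ is the subordinator (non-decreasing L\'evy process) with $\mathbb{E}(e^{-sD_{\alpha_1,\alpha_2}(t)})=e^{-t(C_1s^{\alpha_1}+C_2s^{\alpha_2})}$, $s\ge0$. Its inverse is $Y_{\alpha_1,\alpha_2}(t)=\inf\{s\ge0:D_{\alpha_1,\alpha_2}(s)>t\}$. For $C_1>0$, $U_{\alpha_1,\alpha_2}(t)=\frac{t^{\alpha_1}}{C_1}E_{\alpha_1-\alpha_2,\alpha_1+1}(-C_2t^{\alpha_1-\alpha_2}/C_1)$ with $E_{\alpha,\beta}(x)=\sum_{k\ge0}x^k/\Gamma(k\alpha+\beta)$. The mixed fractional Poisson process (MFPP) is $N^{\alpha_1,\alpha_2}(t)=N(Y_{\alpha_1,\alpha_2}(t))$, where $\{N(t)\}_{t\ge0}$ is a homogeneous Poisson process with intensity $\lambda$ independent of $\{Y_{\alpha_1,\alpha_2}(t)\}_{t\ge0}$. A distribution function $F$ of a positive random variable is subexponential if $\lim_{x\to\infty}(1-F^{*2}(x))/(1-F(x))=2$, where $F^{*2}$ is the distribution function of the sum of two independent copies. *)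

(* Defs.v *)
(* Built on MathComp-Analysis. *)
From HB Require Import structures.
From mathcomp Require Import all_boot all_order all_algebra finmap.
From mathcomp Require Import all_classical all_reals all_analysis.

Set Implicit Arguments.
Unset Strict Implicit.
Unset Printing Implicit Defensive.

Import Order.TTheory GRing.Theory Num.Theory.
Import numFieldNormedType.Exports.

Local Open Scope classical_set_scope.
Local Open Scope ring_scope.

(* The sigma-algebra generated by the maps [X i] for [i] in [I]. *)
Definition sigma_generated {d'} {T : Type} {T' : measurableType d'} {J : Type}
    (I : set J) (X : J -> T -> T') : set (set T) :=
  <<s \bigcup_(i in I) preimage_set_system setT (X i) measurable >>.

Definition independent_classes {d} {T : measurableType d} {R : realType}
    (P : probability T R) (F G : set (set T)) : Prop :=
  forall A B, F A -> G B -> (P (A `&` B) = P A * P B)%E.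

(* Mutual independence: the product rule over all finite subfamilies. *)
Definition mutually_independent {d} {T : measurableType d} {R : realType}
    (P : probability T R) (X : nat -> T -> R) : Prop :=
  forall (J : {fset nat}) (A : nat -> set R),
    (forall i, measurable (A i)) ->
    (P (\bigcap_(i in [set` J]) X i @^-1` A i)
     = \prod_(i <- J) P (X i @^-1` A i))%E.

Definition same_law {d} {T : measurableType d} {R : realType}
    (P : probability T R) (X Y : T -> R) : Prop :=
  forall A : set R, measurable A -> P (X @^-1` A) = P (Y @^-1` A).

Definition iid {d} {T : measurableType d} {R : realType}
    (P : probability T R) (X : nat -> T -> R) : Prop :=
  mutually_independent P X /\ forall i j, same_law P (X i) (X j).

(* Right-continuous with left limits on [0, +oo[. *)
Definition cadlag {R : realType} (f : R -> R) : Prop :=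
  (forall t, 0 <= t -> f x @[x --> t^'+] --> f t) /\
  (forall t, 0 < t -> cvg (f x @[x --> t^'-])).

(* Processes are indexed by [R]; only their values at times [t >= 0] matter.
   Every path is required to be cadlag (not merely almost every path), so that
   events quantifying over uncountably many times are measurable without
   completing [P].  A finite list of times t_0 <= ... <= t_n extends to an
   infinite nondecreasing sequence by repeating t_n, which only adds null
   increments; hence independence of increments can be stated over sequences. *)
Record levy_process {d} {T : measurableType d} {R : realType}
    (P : probability T R) (Z : R -> T -> R) : Prop := LevyProcess {
  levy_measurable : forall t, 0 <= t -> measurable_fun setT (Z t) ;
  levy_start : P [set w | Z 0 w = 0] = 1%E ;
  levy_independent_increments : forall t : nat -> R,
    0 <= t 0%N -> (forall i, t i <= t i.+1) ->
    mutually_independent P (fun i w => Z (t i.+1) w - Z (t i) w) ;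
  levy_stationary_increments : forall s h, 0 <= s -> 0 <= h ->
    same_law P (fun w => Z (s + h) w - Z s w) (fun w => Z h w - Z 0 w) ;
  levy_cadlag : forall w, cadlag (Z ^~ w) }.

Definition subordinator {d} {T : measurableType d} {R : realType}
    (P : probability T R) (D : R -> T -> R) : Prop :=
  levy_process P D /\
  forall w s t, 0 <= s -> s <= t -> D s w <= D t w.

Definition mixed_stable_subordinator {d} {T : measurableType d} {R : realType}
    (P : probability T R) (a1 a2 C1 C2 : R) (D : R -> T -> R) : Prop :=
  subordinator P D /\
  forall t s, 0 <= t -> 0 <= s ->
    ('E_P[fun w => expR (- s * D t w)])%E
    = (expR (- t * (C1 * s `^ a1 + C2 * s `^ a2)))%:E.

(* [inf set0 = 0] in [R]: a path of [D] that never exceeds [t] gets the value 0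
   instead of +oo.  For the subordinators considered here, such paths form a
   null event. *)
Definition inverse_process {T : Type} {R : realType} (D : R -> T -> R)
    (t : R) (w : T) : R :=
  inf [set s | 0 <= s /\ t < D s w].

Definition poisson_process {d} {T : measurableType d} {R : realType}
    (P : probability T R) (lambda : R) (N : R -> T -> nat) : Prop :=
  [/\ levy_process P (fun t w => (N t w)%:R),
      forall w s t, 0 <= s -> s <= t -> (N s w <= N t w)%N &
      forall t k, 0 <= t ->
        P [set w | N t w = k]
        = (expR (- (lambda * t)) * (lambda * t) ^+ k / k`!%:R)%:E].

(* The process N(Y(t)), where Y is the inverse of D. *)
Definition time_changed {T : Type} {R : realType}
    (N : R -> T -> nat) (D : R -> T -> R) (t : R) (w : T) : nat :=
  N (inverse_process D t w) w.

(* Distribution function of [mu], and of the sum of two independent variables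
   with law [mu]. *)
Definition law_df {R : realType} (mu : probability R R) (x : R) : R :=
  fine (mu `]-oo, x]%classic).

Definition law_df2 {R : realType} (mu : probability R R) (x : R) : R :=
  fine ((mu \x mu)%E [set z : R * R | z.1 + z.2 <= x]).

(* If [1 - F] vanishes at some point, the quotient is eventually 0 / 0 = 0, so
   the limit cannot be 2: such laws are excluded. *)
Definition subexponential {R : realType} (mu : probability R R) : Prop :=
  (1 - law_df2 mu x) / (1 - law_df mu x) @[x --> +oo] --> (2 : R).

(* Claims are numbered from 0: [X i] is the (i+1)-st claim. *)
Definition risk_process {T : Type} {R : realType} (u c : R)
    (M : R -> T -> nat) (X : nat -> T -> R) (t : R) (w : T) : R :=
  u + c * t - \sum_(i < M t w) X i w.

Definition ruin_probability {d} {T : measurableType d} {R : realType}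
    (P : probability T R) (c : R) (M : R -> T -> nat) (X : nat -> T -> R)
    (t u : R) : \bar R :=
  P [set w | exists2 s, 0 <= s <= t & risk_process u c M X s w < 0].

(* Main.v *)
Require Import Defs.
From HB Require Import structures.
From mathcomp Require Import all_boot all_order all_algebra finmap.
From mathcomp Require Import all_classical all_reals all_analysis.
From mathcomp Require Import measurable_realfun.
From mathcomp Require Import ring lra.

(** Write [M] for the time-changed process and [S_n] for the sum of the first [n]
    claims, with common tail [F]. As [M] is nondecreasing and the claims are
    positive, ruin before [t] contains the event [S_{M(t)} > u + c t] and is
    almost surely contained in [S_{M(t)} > u]. For subexponential claims
    [P(S_n > u) / F(u)] tends to [n] and is at most [B z^n], for any fixed
    [z > 1]. By the Chernoff bound [P(D(s) <= t) <= exp(t - s)], the inverse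
    [Y(t)] has an exponential moment, hence [z^{M(t)}] has finite mean for some
    [z > 1]. Summing over the values of [M(t)] gives
    [P(S_{M(t)} > u) ~ E(M(t)) F(u)], where [E(M(t)) = lambda E(Y(t))], and
    [F(u + c t) ~ F(u)] makes the two bounds on the ruin probability agree. *)

Set Implicit Arguments.
Unset Strict Implicit.
Unset Printing Implicit Defensive.

Import Order.TTheory GRing.Theory Num.Theory.
Import numFieldNormedType.Exports.

Local Open Scope classical_set_scope.
Local Open Scope ring_scope.

(** * Tails of convolutions *)

Section tails.
Context {R : realType}.
Implicit Types (mu nu : probability R R) (x y : R).

(** Conditioning on the values of [M(t)] only needs a countable sum, but [M(t)] itself reads [N] at
    a random real time. Rather than integrating over paths, the proof rounds [Y(t)] to a grid of
    mesh [1 / n]: on each cell [N] is read at a deterministic time, and monotonicity of [N] traps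
    [M(t)] between the values at the two ends of the cell. Mesh 1 is enough for the exponential
    moment; the mean is obtained by refining the mesh. The tails of the sums [S_n] enter only
    through a one-step recursion, obtained by splitting on whether the newest claim alone exceeds
    [x]. The upper inclusion is only almost sure for two reasons: claims are positive almost surely,
    and the convention [inf set0 = 0] can make the clock jump back to 0 on paths of [D] that never
    exceed the level. *)

Definition tail mu (x : R) : R := fine (mu `]x, +oo[%classic).

(** The part of the tail of the convolution in which the first summand alone does not exceed [x].
    For a nonnegative second summand the rest of the tail is just [tail mu x]. *)
Definition conv_tail_le mu nu (x : R) : R :=
  fine ((mu \x nu)%E [set z : R * R | x < z.1 + z.2 /\ z.1 <= x]).

Lemma tail_ge0 mu x : 0 <= tail mu x.
Proof. by rewrite fine_ge0. Qed.

Lemma tail_EFin mu x : (tail mu x)%:E = mu `]x, +oo[%classic.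
Proof. by rewrite fineK// fin_num_measure. Qed.

Lemma tail_le1 mu x : tail mu x <= 1.
Proof. by rewrite -lee_fin tail_EFin probability_le1. Qed.

Lemma tail_nincr mu x y : x <= y -> tail mu y <= tail mu x.
Proof.
move=> xy; rewrite -lee_fin !tail_EFin le_measure ?inE//.
exact: subitvPl.
Qed.

Lemma tail_cvg0 mu : tail mu x @[x --> +oo] --> (0 : R).
Proof.
pose X : {RV mu >-> R} := HB.pack_for {mfun R >-> R} (@idfun R)
  (isMeasurableFun.Build _ _ _ _ (@idfun R) (@measurable_id _ _ setT)).
have := cvg_ccdfy0 X.
by move/fine_cvg.
Qed.

Lemma measure_itv_oc mu x y : x <= y ->
  mu `]x, y]%classic = (tail mu x - tail mu y)%:E.
Proof.
move=> xy; rewrite EFinB !tail_EFin.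
have -> : `]x, +oo[%classic = `]x, y]%classic `|` `]y, +oo[%classic.
  by apply: itv_bndbnd_setU; rewrite bnd_simp.
rewrite measureU//; last first.
  apply/seteqP; split => // z [] /=; rewrite !in_itv/= andbT => /andP[_ zy].
  by rewrite ltNge zy.
by rewrite addeK// fin_num_measure.
Qed.

Lemma measurable_sum_gt (x : R) : measurable [set z : R * R | x < z.1 + z.2].
Proof.
have mf : measurable_fun setT (fun z : R * R => z.1 + z.2).
  by apply: measurable_funD.
rewrite (_ : [set _ | _] = setT `&` (fun z : R * R => z.1 + z.2) @^-1` `]x, +oo[%classic).
  exact: mf.
by rewrite setTI; apply/seteqP; split => z /=; rewrite in_itv/= andbT.
Qed.

Lemma measurable_sum_gt_le (x : R) :
  measurable [set z : R * R | x < z.1 + z.2 /\ z.1 <= x].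
Proof.
rewrite (_ : [set _ | _] = [set z : R * R | x < z.1 + z.2] `&` (`]-oo, x]%classic `*` setT)).
  by apply: measurableI; [exact: measurable_sum_gt|exact: measurableX].
by apply/seteqP; split => z /=; rewrite in_itv/=; [move=> [-> ->]|move=> [? []]].
Qed.

Lemma product_probability_fin_num mu nu (A : set (R * R)) : measurable A ->
  (mu \x nu)%E A \is a fin_num.
Proof.
move=> mA.
rewrite ge0_fin_numE//; apply: (@le_lt_trans _ _ ((mu \x nu)%E (setT `*` setT))).
  by rewrite le_measure ?inE// setXTT.
rewrite product_measure1E//.
apply: lte_mul_pinfty => //; last by rewrite -ge0_fin_numE// fin_num_measure.
exact: fin_num_measure.
Qed.

Lemma conv_tail_le_EFin mu nu x : (conv_tail_le mu nu x)%:E =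
  (mu \x nu)%E [set z : R * R | x < z.1 + z.2 /\ z.1 <= x].
Proof.
by rewrite fineK// product_probability_fin_num//; exact: measurable_sum_gt_le.
Qed.

Lemma product_sum_gtE mu nu x : nu `[0, +oo[%classic = 1%E ->
  (mu \x nu)%E [set z : R * R | x < z.1 + z.2]
  = (tail mu x + conv_tail_le mu nu x)%:E.
Proof.
move=> nu1; rewrite EFinD conv_tail_le_EFin tail_EFin.
have mA := measurable_sum_gt x; have mB := measurable_sum_gt_le x.
set A := [set z | _ < _]; set B := [set z | _ /\ _].
have nuN : nu `]-oo, 0[%classic = 0%E.
  rewrite (_ : `]-oo, 0[%classic = ~` `[0, +oo[%classic); last by rewrite setCitvr.
  by rewrite probability_setC//; rewrite nu1 subee.
have mC : measurable (`]x, +oo[%classic `*` [set: R]) by exact: measurableX.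
have mN : measurable (setT `*` `]-oo, (0 : R)[%classic : set (R * R)).
  exact: measurableX.
have -> : A = B `|` (A `&` (`]x, +oo[%classic `*` setT)).
  apply/seteqP; split => z /=.
    by move=> Az; case: (leP z.1 x) => zx; [left|right]; rewrite // in_itv/= zx.
  by move=> [[]|[]].
rewrite measureU//; last 2 first.
- exact: measurableI.
- apply/seteqP; split => // z [] [_ /=] zx [_] [] /=.
  by rewrite in_itv/= andbT ltNge zx.
rewrite addeC; congr (_ + _)%E.
rewrite -[RHS]mule1 -(@probability_setT _ _ _ nu).
rewrite -[RHS]product_measure1E//.
(* For the nontrivial inequality the null strip where [z.2 < 0] is added: off it, [x < z.1] already
   forces the sum above [x]. *)
apply/eqP; rewrite eq_le; apply/andP; split.
  by rewrite le_measure ?inE//; exact: measurableI.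
rewrite -[leRHS]adde0.
rewrite -(mule0 (mu setT)) -nuN -product_measure1E//.
apply: le_trans (measureU2 _ _ _) => //; last exact: measurableI.
rewrite le_measure ?inE//; first by apply: measurableU => //; exact: measurableI.
move=> z []/=; rewrite !in_itv/= andbT => xz _.
case: (ltP z.2 0) => z2; first by right.
by left; split=> //; rewrite /A/=; lra.
Qed.

(** The section of the region at [z <= x] has [nu]-mass [tail nu (x - z)], so the pointwise bound
    integrates against [mu]. The indicator covers the range below [b], where an asymptotic
    comparison of tails is not yet available; it integrates to the mass of []x - b, x]]. *)
Lemma conv_tail_le_monotone mu nu nu' (a b x : R) : 0 <= a -> 0 <= b ->
  (forall y, 0 <= y -> tail nu y <= a * tail nu' y + (y < b)%R%:R) ->
  conv_tail_le mu nu x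
  <= a * conv_tail_le mu nu' x + (tail mu (x - b) - tail mu x).
Proof.
move=> a0 b0 H; rewrite -lee_fin EFinD -measure_itv_oc; last lra.
rewrite EFinM !conv_tail_le_EFin.
set A := [set z | _]; have mA : measurable A := measurable_sum_gt_le x.
have secE z : xsection A z = if z <= x then `]x - z, +oo[%classic else set0.
  apply/seteqP; split => y; rewrite /xsection/= inE /A/=.
    by move=> [xz ->] /=; rewrite in_itv/= andbT; lra.
  by case: ifPn => // zx; rewrite /= in_itv/= andbT => ?; split => //; lra.
rewrite /product_measure1.
rewrite -ge0_integralZl//; [|exact: measurable_fun_xsection].
rewrite -[X in (_ <= _ + mu X)%E]setIT -integral_indic//.
rewrite -ge0_integralD//; [|by move=> z _; rewrite mule_ge0| |]; last 2 first.
- by apply: measurable_funeM; exact: measurable_fun_xsection.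
- by apply/measurable_EFinP; exact: measurable_indic.
apply: ge0_le_integral => //.
- exact: measurable_fun_xsection.
- apply: emeasurable_funD; first by apply: measurable_funeM; exact: measurable_fun_xsection.
  by apply/measurable_EFinP; exact: measurable_indic.
move=> z _ /=; rewrite secE indicE.
case: ifPn => zx; last by rewrite !measure0 mule0 add0e lee_fin.
rewrite -!tail_EFin -EFinM -EFinD lee_fin.
have xz : 0 <= x - z by lra.
apply: (le_trans (H _ xz)); rewrite lerD2l.
rewrite (_ : (x - z < b) = (z \in `]x - b, x]%classic)) ?ler_nat ?leqnn//.
apply/idP/idP.
  by move=> ?; rewrite inE/= in_itv/= zx andbT; lra.
by rewrite inE/= in_itv/= => /andP[? _]; lra.
Qed.

(** Since [x <= u + y], the rectangle []u, v]] times []y, +oo[] lies inside the region. *)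
Lemma conv_tail_le_rect mu nu (u v x y : R) : u <= v -> v <= x -> x <= u + y ->
  (tail mu u - tail mu v) * tail nu y <=
  fine ((mu \x nu)%E ([set z : R * R | x < z.1 + z.2 /\ z.1 <= x] `&`
    [set z | u < z.1 <= v])).
Proof.
move=> uv vx xuy.
have mC : measurable ([set z : R * R | x < z.1 + z.2 /\ z.1 <= x] `&`
    [set z | u < z.1 <= v]).
  apply: measurableI; first exact: measurable_sum_gt_le.
  rewrite (_ : [set _ | _] = `]u, v]%classic `*` setT); first exact: measurableX.
  by apply/seteqP; split => z /=; rewrite in_itv/=; [|case].
rewrite -lee_fin fineK; last exact: product_probability_fin_num.
rewrite EFinM -measure_itv_oc// tail_EFin -product_measure1E//.
rewrite le_measure ?inE//; first exact: measurableX.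
by move=> z []/=; rewrite !in_itv/= andbT => /andP[? ?] ?; split; [split|]; lra.
Qed.

End tails.

(** * Subexponential laws *)

Section subexponential_laws.
Context {R : realType}.
Variable mu : probability R R.
Implicit Types x y : R.
Hypothesis mu_pos : mu `]0, +oo[%classic = 1%E.

Lemma pos_tail0 : tail mu 0 = 1.
Proof. by rewrite /tail mu_pos. Qed.

Lemma pos_ge0_law : mu `[0, +oo[%classic = 1%E.
Proof.
apply/eqP; rewrite eq_le probability_le1// -mu_pos le_measure ?inE//.
by apply: subset_itvr; rewrite bnd_simp.
Qed.

(** Two disjoint rectangles fit in the region: []0, y]] times []x, +oo[], and []y, x]] times []x -
    y, +oo[]. *)
Lemma conv_tail_le_lower (nu : probability R R) x y : 0 <= y -> y <= x ->
  (1 - tail mu y) * tail nu x + (tail mu y - tail mu x) * tail nu (x - y)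
  <= conv_tail_le mu nu x.
Proof.
move=> y0 yx.
have H2 : x <= 0 + x by lra.
have H3 : x <= y + (x - y) by lra.
have := lerD (@conv_tail_le_rect _ mu nu _ _ _ _ y0 yx H2)
             (@conv_tail_le_rect _ mu nu _ _ _ _ yx (lexx x) H3).
rewrite pos_tail0 => /le_trans; apply.
have mS u v : measurable [set z : R * R | u < z.1 <= v].
  rewrite (_ : [set _ | _] = `]u, v]%classic `*` setT); first exact: measurableX.
  by apply/seteqP; split => z /=; rewrite in_itv/=; [|case].
have mC u v : measurable ([set z : R * R | x < z.1 + z.2 /\ z.1 <= x] `&`
    [set z | u < z.1 <= v]).
  by apply: measurableI; [exact: measurable_sum_gt_le|exact: mS].
rewrite -lee_fin EFinD [leRHS]conv_tail_le_EFin.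
rewrite (fineK (product_probability_fin_num mu nu (mC 0 y))).
rewrite (fineK (product_probability_fin_num mu nu (mC y x))).
rewrite -measureU//.
  rewrite le_measure ?inE//; first exact: measurableU.
    exact: measurable_sum_gt_le.
  by move=> z [[]|[]].
by apply/seteqP; split => // z [] [_ /= /andP[_ zy]] [_ /= /andP[yz _]]; lra.
Qed.

Lemma law_df_tail x : 1 - law_df mu x = tail mu x.
Proof.
rewrite /law_df /tail -setCitvr probability_setC//.
have := tail_EFin mu x; rewrite /tail => <-.
by rewrite -EFinB/=; lra.
Qed.

Lemma law_df2_tail x : 1 - law_df2 mu x = tail mu x + conv_tail_le mu mu x.
Proof.
rewrite /law_df2.
rewrite (_ : [set z | _] = ~` [set z : R * R | x < z.1 + z.2]); last first.
  by apply/seteqP; split => z /=; [move=> ?; apply/negP; rewrite -leNgt|move/negP; rewrite -leNgt].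
have mA := measurable_sum_gt x.
have : ((mu \x mu) [set z : R * R | (x < z.1 + z.2)%R] +
    (mu \x mu) (~` [set z : R * R | (x < z.1 + z.2)%R]) = 1)%E.
  rewrite -measureU//; [|exact: measurableC|by rewrite setICr].
  rewrite setUv -setXTT [LHS]product_measure1E//.
  by rewrite -[RHS]mul1e; congr (_ * _)%E; exact: probability_setT.
rewrite product_sum_gtE; last exact: pos_ge0_law.
have := product_probability_fin_num mu mu (measurableC mA).
case: ((mu \x mu)%E _) => // r _.
by rewrite -EFinD => -[] /=; lra.
Qed.

Hypothesis mu_subexp : subexponential mu.

(** If the tail vanished far out, division by 0 would give the quotient the value 0, at distance 2
    from its limit. *)
Lemma subexponential_tail_gt0 x : 0 < tail mu x.
Proof.
have [y [xy]] : exists y, x < y /\ 0 < tail mu y.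
  move/cvgrPdist_lt : mu_subexp => /(_ 1 ltr01)[M [Mr H]].
  pose y := Num.max x M + 1; exists y.
  have My : M < y by rewrite /y ltr_pwDr// le_max lexx orbT.
  have xy : x < y by rewrite /y ltr_pwDr// le_max lexx.
  split=> //; have := H _ My.
  rewrite law_df_tail; have := tail_ge0 mu y.
  rewrite le_eqVlt => /predU1P[<-|//]; rewrite invr0 mulr0 subr0.
  by rewrite ger0_norm//; lra.
move/lt_le_trans; apply; apply: tail_nincr; exact: ltW.
Qed.

Lemma subexponential_conv_ratio :
  conv_tail_le mu mu x / tail mu x @[x --> +oo] --> (1 : R).
Proof.
have -> : (1 : R) = 2 - 1 by lra.
apply: cvg_trans (cvgB mu_subexp (cvg_cst (1 : R))); apply: near_eq_cvg; near=> x.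
have t0 := subexponential_tail_gt0 x.
rewrite [LHS](_ : _ = (1 - law_df2 mu x) / (1 - law_df mu x) - 1)//.
by rewrite law_df_tail law_df2_tail; field; rewrite gt_eqF.
Unshelve. all: by end_near. Qed.

(* Restricting the first summand to [0, y] and to ]y, x] bounds the convolution
   ratio, which tends to 1, from below by the ratio in question. *)
Lemma subexponential_long_tailed y : 0 <= y ->
  tail mu (x - y) / tail mu x @[x --> +oo] --> (1 : R).
Proof.
have t1 := pos_tail0.
move=> y0.
(* The upper function is [conv_tail_le_lower] solved for the ratio; its denominator is positive once
   [tail mu x < tail mu y]. *)
apply: (@squeeze_cvgr _ _ _ _ (fun=> 1)
  (fun x => (conv_tail_le mu mu x / tail mu x - (1 - tail mu y)) / (tail mu y - tail mu x))); first last.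
- rewrite [X in _ --> X](_ : _ = (1 - (1 - tail mu y)) / (tail mu y - 0)); last first.
    by field; rewrite gt_eqF// subexponential_tail_gt0.
  apply: cvgM.
    by apply: cvgB; [exact: subexponential_conv_ratio|exact: cvg_cst].
  apply: cvgV; first by rewrite subr0 gt_eqF// subexponential_tail_gt0.
  by apply: cvgB; [exact: cvg_cst|exact: tail_cvg0].
- exact: cvg_cst.
near=> x.
have tx := subexponential_tail_gt0 x.
have yx : y <= x by near: x; apply: nbhs_pinfty_ge; exact: num_real.
have txy : tail mu x < tail mu y.
  near: x.
  have /cvgrPdist_lt := tail_cvg0 mu.
  move=> /(_ _ (subexponential_tail_gt0 y)); apply: filterS => x.
  by rewrite sub0r normrN ger0_norm// tail_ge0.
rewrite ler_pdivlMr// mul1r tail_nincr/=; last lra.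
rewrite ler_pdivlMr ?subr_gt0//.
have := conv_tail_le_lower mu y0 yx => H.
rewrite -(ler_pM2r tx) mulrBl divfK ?gt_eqF//.
rewrite mulrAC divfK ?gt_eqF//; lra.
Unshelve. all: by end_near. Qed.

(** Abstracts the laws of the partial sums. [nu 0] is the law of the empty sum, a point mass at 0,
    whence the restriction to [0 <= x]. *)
Variable nu : nat -> probability R R.
Hypothesis nu0 : forall x, 0 <= x -> tail (nu 0%N) x = 0.
Hypothesis nuS : forall n x,
  tail (nu n.+1) x = tail mu x + conv_tail_le mu (nu n) x.

(** In the recursion [nuS], replacing [nu n] by about [n] copies of [mu] costs only the mass of []x
    - b, x]], which is negligible against [tail mu x] because [mu] is long-tailed. The matching
    lower bound comes from the single rectangle given by [y = x] in [conv_tail_le_lower]. *)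
Lemma subexponential_convn n :
  tail (nu n) x / tail mu x @[x --> +oo] --> (n%:R : R).
Proof.
elim: n => [|n IH].
  apply: cvg_near_cst; near=> x.
  by rewrite nu0 ?mul0r//; near: x; apply: nbhs_pinfty_ge; exact: num_real.
apply/cvgrPdist_le => e e0.
have e20 : 0 < e / 2 by rewrite divr_gt0.
(* Beyond [b] the induction hypothesis gives the bound; below [b] the indicator does, as tails are
   at most 1. *)
have [b [b0 Hb]] : exists b, 0 <= b /\
    forall y, 0 <= y -> tail (nu n) y <= (n%:R + e / 2) * tail mu y + (y < b)%R%:R.
  move/cvgrPdist_le : IH => /(_ _ e20)[M [_ HM]].
  exists (Num.max M 0 + 1); split; first by rewrite addr_ge0// le_max lexx orbT.
  move=> y y0; have ty := subexponential_tail_gt0 y.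
  case: ltP => yM.
    by rewrite ler_wpDl ?tail_le1// mulr_ge0 ?addr_ge0// ltW.
  have /HM : M < y by apply: lt_le_trans yM; rewrite ltr_pwDr// le_max lexx.
  by rewrite distrC ler_norml => /andP[_ Hy]; rewrite addr0 -ler_pdivrMr//; lra.
have lo : 1 + (1 - tail mu x) * (tail (nu n) x / tail mu x) @[x --> +oo]
    --> 1 + (1 - 0) * (n%:R : R).
  apply: cvgD; first exact: cvg_cst.
  by apply: cvgM => //; apply: cvgB; [exact: cvg_cst|exact: tail_cvg0].
(* The limit is [n + 1 + e / 2]: half of the error is spent here, the other half on closeness to the
   limit. *)
have up : 1 + (n%:R + e / 2) * (conv_tail_le mu mu x / tail mu x)
    + (tail mu (x - b) / tail mu x - 1) @[x --> +oo]
    --> (1 + (n%:R + e / 2) * 1 + (1 - 1) : R).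
  apply: cvgD; last by apply: cvgB; [exact: subexponential_long_tailed|exact: cvg_cst].
  apply: cvgD; first exact: cvg_cst.
  by apply: cvgM; [exact: cvg_cst|exact: subexponential_conv_ratio].
move/cvgrPdist_le : lo => /(_ _ e20) lo; move/cvgrPdist_le : up => /(_ _ e20) up.
near=> x.
have tx := subexponential_tail_gt0 x.
have x0 : 0 <= x by near: x; apply: nbhs_pinfty_ge; exact: num_real.
have : `|1 + (1 - 0) * n%:R - (1 + (1 - tail mu x) * (tail (nu n) x / tail mu x))| <= e / 2.
  by near: x.
have : `|1 + (n%:R + e / 2) * 1 + (1 - 1) - (1 + (n%:R + e / 2) * (conv_tail_le mu mu x / tail mu x)
    + (tail mu (x - b) / tail mu x - 1))| <= e / 2.
  by near: x.
rewrite !ler_norml => /andP[U _] /andP[_ L].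
have ne0 : 0 <= n%:R + e / 2 by rewrite addr_ge0// ltW.
have U' := conv_tail_le_monotone mu x ne0 b0 Hb.
have L' := conv_tail_le_lower (nu n) x0 (lexx x).
rewrite nuS -natr1.
set K := conv_tail_le _ _ _ in U' L' *; set A := _ * tail _ x in L' *.
set B := conv_tail_le mu mu x in U U'.
have A' : 1 + A / tail mu x <= 1 + K / tail mu x.
  by rewrite lerD2l ler_pM2r ?invr_gt0//; lra.
have B' : 1 + K / tail mu x <= 1 + ((n%:R + e / 2) * B + (tail mu (x - b) - tail mu x)) / tail mu x.
  by rewrite lerD2l ler_pM2r ?invr_gt0.
have <- : 1 + K / tail mu x = (tail mu x + K) / tail mu x by rewrite mulrDl divff ?gt_eqF.
have eA : A / tail mu x = (1 - tail mu x) * (tail (nu n) x / tail mu x) by rewrite /A mulrA.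
have eB : ((n%:R + e / 2) * B + (tail mu (x - b) - tail mu x)) / tail mu x
  = (n%:R + e / 2) * (B / tail mu x) + (tail mu (x - b) / tail mu x - 1).
  by rewrite mulrDl mulrBl divff ?gt_eqF// mulrA.
rewrite eA in A'; rewrite eB in B'.
apply/andP; split; lra.
Unshelve. all: by end_near. Qed.

(* Up to the factor [C], the constants solve [a 0 = 0] and
   [a n.+1 = 1 + z * a n]: beyond [M] one convolution costs at most a factor
   [z], and below [M] the tail is bounded below by [tail mu M]. *)
Lemma kesten_bound (z : R) : 1 < z -> exists2 B, 0 <= B &
  forall n x, 0 <= x -> tail (nu n) x <= B * z ^+ n * tail mu x.
Proof.
move=> z1.
have z10 : 0 < z - 1 by lra.
have [M [M0 HM]] : exists M, 0 <= M /\
    forall x, M <= x -> conv_tail_le mu mu x <= z * tail mu x.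
  move/cvgrPdist_le : subexponential_conv_ratio => /(_ _ z10)[M [_ HM]].
  exists (Num.max M 0 + 1); split; first by rewrite addr_ge0// le_max lexx orbT.
  move=> x Mx; have tx := subexponential_tail_gt0 x.
  have /HM : M < x by apply: lt_le_trans Mx; rewrite ltr_pwDr// le_max lexx.
  by rewrite distrC ler_norml => /andP[_ Hx]; rewrite -ler_pdivrMr//; lra.
have tM := subexponential_tail_gt0 M.
(* The summand 1 pays for the term [tail mu x] of the recursion beyond [M]; the inverse makes
   [C * tail mu x] at least 1 below [M]. *)
pose C := 1 + (tail mu M)^-1.
have C0 : 0 <= C by rewrite addr_ge0// invr_ge0 ltW.
exists (C / (z - 1)); first by rewrite divr_ge0// ltW.
have H n x : 0 <= x -> tail (nu n) x <= C * ((z ^+ n - 1) / (z - 1)) * tail mu x.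
  elim: n x => [|n IH] x x0; first by rewrite nu0// expr0 subrr mul0r mulr0 mul0r.
  have tx := subexponential_tail_gt0 x.
  set a := C * _ in IH.
  have a0 : 0 <= a.
    by rewrite mulr_ge0// divr_ge0// subr_ge0 ?exprn_ege1// ltW.
  have -> : C * ((z ^+ n.+1 - 1) / (z - 1)) = C + z * a.
    by rewrite /a exprS; field; rewrite gt_eqF.
  have {}IH y : 0 <= y -> tail (nu n) y <= a * tail mu y + (y < 0)%R%:R.
    by move=> y0; rewrite ltNge y0 addr0 IH.
  have := conv_tail_le_monotone mu x a0 (lexx 0) IH.
  rewrite subr0 subrr addr0 => HK.
  case: (leP M x) => xM.
    rewrite nuS mulrDl; apply: lerD.
      by rewrite ler_peMl ?(ltW tx)// lerDl invr_ge0 ltW.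
    apply: (le_trans HK); rewrite [z * a]mulrC -[leRHS]mulrA.
    by rewrite ler_wpM2l// HM.
  apply: (@le_trans _ _ 1); first exact: tail_le1.
  rewrite mulrDl ler_wpDr//.
    by rewrite mulr_ge0 ?tail_ge0// mulr_ge0//; lra.
  rewrite mulrDl mul1r ler_wpDl// ?tail_ge0//.
  by rewrite ler_pdivlMl// mulr1 tail_nincr// ltW.
move=> n x x0; apply: (le_trans (H n x x0)).
rewrite ler_wpM2r ?tail_ge0// mulrAC -!mulrA ler_wpM2l//.
by rewrite ler_wpM2r ?invr_ge0 ?(ltW z10)// gerBl.
Qed.

(** Dominated convergence for the series of [p k * tail (nu k) x / tail mu x]: each term tends to
    [p k * k], and [kesten_bound] dominates it by [B * p k * z ^+ k], uniformly in [x >= 0]. The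
    three errors of size [e / 3] are the two series remainders and the finite part. *)
Lemma subexponential_mixture (p : nat -> R) (W : R -> R) (z m : R) :
  1 < z -> (forall k, 0 <= p k) ->
  (\sum_(k <oo) (p k * z ^+ k)%:E < +oo)%E ->
  (\sum_(k <oo) (p k * k%:R)%:E = m%:E)%E ->
  (forall x, 0 <= x -> (\sum_(k <oo) (p k * tail (nu k) x)%:E = (W x)%:E)%E) ->
  W x / tail mu x @[x --> +oo] --> m.
Proof.
move=> z1 p0 pz pm WE.
have z0 : 0 <= z by lra.
have [B B0 HB] := kesten_bound z1.
have pk0 k : (0 <= (p k * k%:R)%:E)%E by rewrite lee_fin mulr_ge0.
have pz0 k : (0 <= (p k * z ^+ k)%:E)%E by rewrite lee_fin mulr_ge0// exprn_ge0.
have pt0 x k : (0 <= (p k * tail (nu k) x)%:E)%E.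
  by rewrite lee_fin mulr_ge0// tail_ge0.
apply/cvgrPdist_le => e e0.
have e30 : 0 < e / 3 by lra.
(* [B] may be 0, hence the divisor [B + 1]. *)
pose d := e / 3 / (B + 1).
have d0 : 0 < d by rewrite divr_gt0//; lra.
have Bd : B * d <= e / 3.
  have : d * (B + 1) = e / 3 by rewrite divfK// gt_eqF//; lra.
  lra.
have near_tail (f : nat -> \bar R) r : (forall k, 0 <= f k)%E -> 0 < r ->
    (\sum_(k <oo) f k < +oo)%E -> \forall n \near \oo, (\sum_(n <= k <oo) f k <= r%:E)%E.
  move=> f0 r0 /nneseries_tail_cvg => /(_ (fun k _ => f0 k)).
  move/fine_cvgP => [ff /cvgrPdist_le/(_ _ r0)] H; near=> n.
  have fn : (\sum_(n <= k <oo) f k)%E \is a fin_num by near: n.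
  rewrite -(fineK fn) lee_fin.
  have : `|0 - fine (\sum_(n <= k <oo) f k)%E| <= r by near: n.
  by rewrite sub0r normrN; apply: le_trans; exact: ler_norm.
have [n [H1 H2]] : exists n, (\sum_(n <= k <oo) (p k * z ^+ k)%:E <= d%:E)%E /\
    (\sum_(n <= k <oo) (p k * k%:R)%:E <= (e / 3)%:E)%E.
  have [N _ HN] := filterI (near_tail _ _ pz0 d0 pz)
     (near_tail _ _ pk0 e30 (eq_ind_r (fun t => (t < +oo)%E) (ltry _) pm)).
  by exists N; apply: HN => /=.
have split f : (forall k, 0 <= f k)%E -> (\sum_(k <oo) f k =
   \sum_(0 <= k < n) f k + \sum_(n <= k <oo) f k :> \bar R)%E.
  by move=> f0; rewrite (@nneseries_split _ f 0 n)// add0n.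
have cS : \sum_(0 <= k < n) p k * (tail (nu k) x / tail mu x) @[x --> +oo]
    --> (\sum_(0 <= k < n) p k * k%:R : R).
  elim: (n) => [|j IH].
    by under eq_cvg do rewrite big_nil; rewrite big_nil; exact: cvg_cst.
  under eq_cvg do rewrite big_nat_recr//=; rewrite big_nat_recr//=.
  by apply: cvgD => //; apply: cvgM; [exact: cvg_cst|exact: subexponential_convn].
move/cvgrPdist_le : cS => /(_ _ e30) cS; near=> x.
have x0 : 0 <= x by near: x; apply: nbhs_pinfty_ge; exact: num_real.
have tx := subexponential_tail_gt0 x.
have : `|\sum_(0 <= k < n) p k * k%:R -
  \sum_(0 <= k < n) p k * (tail (nu k) x / tail mu x)| <= e / 3 by near: x.
set S := \sum_(0 <= k < n) p k * k%:R.
set Sx := \sum_(0 <= k < n) p k * (tail (nu k) x / tail mu x) => HS.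
have mS : `|m - S| <= e / 3.
  have := pm; rewrite split// sumEFin -/S => Hm.
  have T0 : (0 <= \sum_(n <= k <oo) (p k * k%:R)%:E)%E.
    by apply: nneseries_ge0.
  move: H2 T0 Hm; case: (\sum_(n <= k <oo) _)%E => //= r.
  rewrite !lee_fin => r1 r2 [<-].
  by rewrite addrAC subrr add0r ger0_norm.
have WS : `|W x / tail mu x - Sx| <= e / 3.
  have T1 : (\sum_(n <= k <oo) (p k * tail (nu k) x)%:E <= (e / 3 * tail mu x)%:E)%E.
    apply: (@le_trans _ _ (\sum_(n <= k <oo) ((B * tail mu x)%:E * (p k * z ^+ k)%:E))%E).
      apply: lee_nneseries => // k _.
      rewrite -EFinM lee_fin mulrCA ler_wpM2l//.
      by apply: (le_trans (HB k x x0)); rewrite mulrAC.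
    rewrite nneseriesZl//.
    apply: (@le_trans _ _ ((B * tail mu x)%:E * d%:E)%E).
      by rewrite lee_wpmul2l// lee_fin mulr_ge0// ltW.
    by rewrite -EFinM lee_fin mulrAC ler_wpM2r// ltW.
  have T0 : (0 <= \sum_(n <= k <oo) (p k * tail (nu k) x)%:E)%E.
    by apply: nneseries_ge0.
  have := WE x x0; rewrite split// sumEFin.
  have -> : \sum_(0 <= k < n) p k * tail (nu k) x = Sx * tail mu x.
    rewrite /Sx mulr_suml; apply: eq_bigr => k _.
    by rewrite mulrA divfK// gt_eqF.
  move: T1 T0; case: (\sum_(n <= k <oo) _)%E => //= r.
  rewrite !lee_fin => r1 r2 [<-].
  rewrite mulrDl mulfK ?gt_eqF// addrAC subrr add0r ger0_norm; last first.
    by rewrite divr_ge0// ltW.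
  by rewrite ler_pdivrMr.
have -> : m - W x / tail mu x = (m - S) + (S - Sx) - (W x / tail mu x - Sx) by ring.
apply: (le_trans (ler_normB _ _)).
have := ler_normD (m - S) (S - Sx); lra.
Unshelve. all: by end_near. Qed.

End subexponential_laws.

(** * Sums of independent claims *)

Section independent_sums.
Context d (T : measurableType d) (R : realType) (P : probability T R).

(** Conditionally on [G] the pair has the product law: the normalized restriction of [P] to [G],
    pushed forward, agrees with the product on rectangles, and product measures are unique. The
    normalization forces the separate treatment of a null [G]. *)
Lemma independent_pair_law (U V : {RV P >-> R}) (G : set T) :
  measurable G ->
  (forall A B, measurable A -> measurable B ->
    P (U @^-1` A `&` V @^-1` B `&` G) = (P (U @^-1` A) * P (V @^-1` B) * P G)%E) ->
  forall E, measurable E ->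
    P ((fun w => (U w, V w)) @^-1` E `&` G)
    = ((distribution P U \x distribution P V) E * P G)%E.
Proof.
move=> mG H E mE.
have mUV : measurable_fun setT (fun w => (U w, V w)) by exact: measurable_fun_pair.
have mUVE : measurable ((fun w => (U w, V w)) @^-1` E).
  by rewrite -[X in measurable X]setTI; exact: mUV.
have [PG0|PG0] := eqVneq (P G) 0%E.
  rewrite PG0 mule0; apply/eqP; rewrite eq_le measure_ge0 andbT -PG0.
  by rewrite le_measure ?inE//; exact: measurableI.
have [g g0 PGE] : exists2 g : R, 0 < g & P G = g%:E.
  exists (fine (P G)); last by rewrite fineK// fin_num_measure.
  by rewrite fine_gt0// lt0e PG0 measure_ge0/= ltey_eq fin_num_measure.
have gV0 : 0 <= g^-1 by rewrite invr_ge0 ltW.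
(* The measure structure of [pushforward] depends on the proof [mUV], which
   canonical structure inference cannot supply. *)
pose m0 := measure_function_pushforward__canonical__measure_function_Measure
  (mrestr P mG) mUV.
pose m' := mscale (NngNum gV0) m0.
have -> : P ((fun w => (U w, V w)) @^-1` E `&` G) = (m' E * g%:E)%E.
  by rewrite /m' /mscale/= muleAC -EFinM mulVf ?gt_eqF// mul1e.
rewrite PGE; congr (_ * _)%E; apply/esym.
apply: product_measure_unique => // A B mA mB.
rewrite [LHS](_ : _ = (g^-1)%:E * P (U @^-1` A `&` V @^-1` B `&` G))%E//.
by rewrite H// PGE muleC -muleA -EFinM mulfV ?gt_eqF// mule1.
Qed.
(** Summed among measurable functions, so that the result is again a random variable with a
    [distribution]. *)
Definition partial_sum (X : nat -> {RV P >-> R}) n : {RV P >-> R} :=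
  (\sum_(i < n) (X i : {mfun T >-> R}))%R.

Variable X : nat -> {RV P >-> R}.

Lemma partial_sumE n w : partial_sum X n w = \sum_(i < n) X i w.
Proof. by rewrite /partial_sum mfun_sum. Qed.

Lemma partial_sumS n w : partial_sum X n.+1 w = X n w + partial_sum X n w.
Proof. by rewrite !partial_sumE big_ord_recr/= addrC. Qed.

Lemma tail_distributionE (U : {RV P >-> R}) x :
  (tail (distribution P U) x)%:E = P [set w | x < U w].
Proof.
rewrite tail_EFin [LHS](_ : _ = P (U @^-1` `]x, +oo[%classic))//; congr (P _).
by apply/seteqP; split => w /=; rewrite in_itv/= andbT.
Qed.

Lemma measurable_preimage (U : {RV P >-> R}) A : measurable A -> measurable (U @^-1` A).
Proof. by move=> mA; exact: measurable_funPTI. Qed.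

Lemma measurable_rv_gt (U : {RV P >-> R}) x : measurable [set w | x < U w].
Proof.
rewrite (_ : [set _ | _] = U @^-1` `]x, +oo[); first exact: measurable_preimage.
by apply/seteqP; split => w /=; rewrite in_itv/= andbT.
Qed.

Lemma measurable_addr_in (A : set R) : measurable A ->
  measurable [set z : R * R | A (z.1 + z.2)].
Proof.
move=> mA; have mf : measurable_fun setT (fun z : R * R => z.1 + z.2).
  by apply: measurable_funD.
by rewrite -[X in measurable X]setTI; exact: mf.
Qed.

Hypothesis indX : mutually_independent P X.

Let cyl (B : nat -> set R) (J : {fset nat}) : set T :=
  \bigcap_(i in [set` J]) X i @^-1` B i.

Let measurable_cyl B J : (forall i, measurable (B i)) -> measurable (cyl B J).
Proof.
by move=> mB; apply: bigcap_measurableType => i _; exact: measurable_preimage.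
Qed.

(** The induction must carry an arbitrary event on later claims: the step from [n] to [n.+1] moves
    [X n] out of that event and into the sum. *)
Let sum_indep_above n := forall (A : set R) B (J : {fset nat}),
  measurable A -> (forall i, measurable (B i)) ->
  (forall i, i \in J -> (n <= i)%N) ->
  P (partial_sum X n @^-1` A `&` cyl B J)
  = (P (partial_sum X n @^-1` A) * P (cyl B J))%E.

Let pair_law_above n : sum_indep_above n -> forall B (J : {fset nat}),
  (forall i, measurable (B i)) -> (forall i, i \in J -> (n < i)%N) ->
  forall E, measurable E ->
    P ((fun w => (X n w, partial_sum X n w)) @^-1` E `&` cyl B J)
    = ((distribution P (X n) \x distribution P (partial_sum X n)) E * P (cyl B J))%E.
Proof.
move=> Hn B J mB nJ E mE; apply: independent_pair_law => //.
  exact: measurable_cyl.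
move=> A1 A2 mA1 mA2.
have nNJ : n \notin J by apply/negP => /nJ; rewrite ltnn.
(* Constraining coordinate [n] by [A1] absorbs the event on [X n] into the cylinder, to which the
   induction hypothesis applies. *)
pose B' i := if i == n then A1 else B i.
have mB' i : measurable (B' i) by rewrite /B'; case: ifP.
have B'E i : i \in J -> B' i = B i.
  by move=> iJ; rewrite /B'; case: eqP => // ni; move: nNJ; rewrite -ni iJ.
have cylE : cyl B' (n |` J)%fset = X n @^-1` A1 `&` cyl B J.
  apply/seteqP; split => w.
    move=> H; split; first by have := H n (fset1U1 _ _); rewrite /B' eqxx.
    by move=> i iJ; have := H i (fset1Ur _ iJ); rewrite B'E.
  move=> [H1 H2] i; rewrite /= in_fset1U => /orP[/eqP ->|iJ].
    by rewrite /B' eqxx.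
  by rewrite B'E//; exact: H2.
rewrite [X in P X = _](_ : _ = partial_sum X n @^-1` A2 `&` cyl B' (n |` J)%fset); last first.
  by rewrite cylE setIA [X in X `&` _ = _]setIC.
rewrite Hn//; last by move=> i; rewrite in_fset1U => /orP[/eqP ->//|/nJ/ltnW].
rewrite [P (cyl B' _)]indX// big_fsetU1//= {1}/B' eqxx.
rewrite [P (cyl B _)]indX// muleA [X in (X * _)%E]muleC; congr (_ * _)%E.
by apply: eq_big_seq => i iJ; rewrite B'E.
Qed.

Let sum_indep_aboveP n : sum_indep_above n.
Proof.
elim: n => [|n IH] A B J mA mB nJ.
  have [A0|A0] := pselect (A 0).
    rewrite (_ : partial_sum X 0 @^-1` A = setT); last first.
      by apply/seteqP; split => // w _ /=; rewrite partial_sumE big_ord0.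
    by rewrite setTI probability_setT mul1e.
  rewrite (_ : partial_sum X 0 @^-1` A = set0); last first.
    by apply/seteqP; split => // w /=; rewrite partial_sumE big_ord0.
  by rewrite set0I measure0 mul0e.
have mE := measurable_addr_in mA.
have SE : partial_sum X n.+1 @^-1` A =
    (fun w => (X n w, partial_sum X n w)) @^-1` [set z : R * R | A (z.1 + z.2)].
  by apply/seteqP; split => w /=; rewrite partial_sumS.
have := pair_law_above IH (J := fset0) (B := B) mB _ mE.
rewrite {1 2}/cyl set_fset0 bigcap_set0 setIT probability_setT mule1 => H0.
by rewrite SE pair_law_above// H0.
Qed.

Lemma partial_sum_pair_law n E : measurable E ->
  P ((fun w => (X n w, partial_sum X n w)) @^-1` E)
  = (distribution P (X n) \x distribution P (partial_sum X n))%E E.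
Proof.
move=> mE; have := pair_law_above (@sum_indep_aboveP n) (J := fset0)
  (B := fun=> setT) (fun=> measurableT) _ mE.
by rewrite /cyl set_fset0 bigcap_set0 setIT probability_setT mule1 => ->.
Qed.

Hypothesis lawX : forall i j, same_law P (X i) (X j).
Hypothesis posX : forall i, P [set w | 0 < X i w] = 1%E.

Let mu : probability R R := distribution P (X 0%N).
Let nu n : probability R R := distribution P (partial_sum X n).

Lemma measurable_all_pos : measurable (\bigcap_i [set w | 0 < X i w]).
Proof.
by apply: bigcap_measurableType => i _; exact: measurable_rv_gt.
Qed.

Lemma all_pos_ae : P (~` \bigcap_i [set w | 0 < X i w]) = 0%E.
Proof.
apply: measure_negligible; first exact/measurableC/measurable_all_pos.
rewrite setC_bigcap; apply: negligible_bigcup => i.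
have mi := measurable_rv_gt (X i) 0.
apply/negligibleP; first exact: measurableC.
by rewrite [LHS](probability_setC P mi) posX subee.
Qed.

Lemma claim_law_pos : mu `]0, +oo[%classic = 1%E.
Proof.
rewrite -(posX 0) /mu /distribution/= /pushforward/=; congr (P _).
by apply/seteqP; split => w /=; rewrite in_itv/= andbT.
Qed.

Lemma partial_sum_law_ge0 n : nu n `[0, +oo[%classic = 1%E.
Proof.
apply/eqP; rewrite eq_le probability_le1//=.
have <- : P (\bigcap_i [set w | 0 < X i w]) = 1%E.
  have := probability_setC P (measurableC measurable_all_pos).
  by rewrite all_pos_ae setCK sube0.
rewrite le_measure ?inE//; first exact: measurable_all_pos.
  exact: measurable_preimage.
move=> w H; rewrite /= in_itv/= andbT partial_sumE sumr_ge0// => i _.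
by apply/ltW; exact: H.
Qed.

Lemma partial_sum_law0 x : 0 <= x -> tail (nu 0) x = 0.
Proof.
move=> x0; apply: EFin_inj; rewrite tail_distributionE.
rewrite (_ : [set _ | _] = set0) ?measure0//; apply/seteqP; split => // w /=.
by rewrite partial_sumE big_ord0 ltNge x0.
Qed.

Lemma partial_sum_lawS n x :
  tail (nu n.+1) x = tail mu x + conv_tail_le mu (nu n) x.
Proof.
apply: EFin_inj; rewrite -product_sum_gtE; last exact: partial_sum_law_ge0.
have mE := measurable_sum_gt x.
rewrite tail_distributionE.
rewrite [LHS](_ : _ = P ((fun w => (X n w, partial_sum X n w)) @^-1`
    [set z : R * R | x < z.1 + z.2])); last first.
  by congr (P _); apply/seteqP; split => w /=; rewrite partial_sumS.
rewrite partial_sum_pair_law//.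
(* The newest claim is [X n], not [X 0]; equality of the two laws passes to the products through
   rectangles. *)
apply: product_measure_unique => // A B mA mB.
rewrite [LHS]product_measure1E//; congr (_ * _)%E.
exact: lawX.
Qed.

End independent_sums.

(** * The inverse process as a random clock *)

Section inverse_paths.
Context {T : Type} {R : realType}.
Variables (D : R -> T -> R) (w : T).
Hypothesis D_nd : forall s t, 0 <= s -> s <= t -> D s w <= D t w.

Let A t := [set s | 0 <= s /\ t < D s w].

Let A_lb t : lbound (A t) 0.
Proof. by move=> s []. Qed.

Lemma inverse_process_le t s : 0 <= s -> t < D s w -> inverse_process D t w <= s.
Proof. by move=> s0 ts; apply: ge_inf; [exists 0; exact: A_lb|split]. Qed.

Lemma inverse_process_out t : (forall s, 0 <= s -> D s w <= t) ->
  inverse_process D t w = 0.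
Proof.
move=> H; rewrite /inverse_process (_ : [set s | _] = set0) ?inf0//.
by apply/seteqP; split => // s /= [s0]; rewrite ltNge H.
Qed.

Lemma crosses_or_out t :
  (exists2 s, 0 <= s & t < D s w) \/ (forall s, 0 <= s -> D s w <= t).
Proof.
have [H|H] := pselect (exists2 s, 0 <= s & t < D s w); [by left|right].
by move=> s s0; rewrite leNgt; apply/negP => ts; apply: H; exists s.
Qed.

Lemma inverse_process_ge0 t : 0 <= inverse_process D t w.
Proof.
have [[s s0 ts]|/inverse_process_out->//] := crosses_or_out t.
by apply: lb_le_inf; [exists s|exact: A_lb].
Qed.

Lemma inverse_process_adherent t x : (exists2 s, 0 <= s & t < D s w) ->
  inverse_process D t w < x -> exists s, [/\ 0 <= s, s < x & t < D s w].
Proof.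
move=> [s s0 ts] Yx.
have e0 : 0 < x - inverse_process D t w by rewrite subr_gt0.
have [|r [r0 tr] rx] := inf_adherent e0 (E := A t).
  by split; [exists s|exists 0; exact: A_lb].
by exists r; split => //; move: rx; rewrite /inverse_process addrC subrK.
Qed.

Lemma inverse_process_crosses t x : (exists2 s, 0 <= s & t < D s w) ->
  inverse_process D t w < x -> t < D x w.
Proof.
move=> /inverse_process_adherent H /H[s [s0 sx ts]].
by apply: (lt_le_trans ts); rewrite D_nd// ltW.
Qed.

Lemma inverse_process_gt t s : 0 <= s -> s < inverse_process D t w -> D s w <= t.
Proof.
move=> s0 sY; rewrite leNgt; apply/negP => ts.
by move: sY; rewrite ltNge inverse_process_le.
Qed.

(** Without a crossing of level [t] the default value gives 0 at [t], while the value at [s] may be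
    positive. *)
Lemma inverse_process_nd s t : s <= t -> (exists2 r, 0 <= r & t < D r w) ->
  inverse_process D s w <= inverse_process D t w.
Proof.
move=> st [r r0 tr]; apply: lb_le_inf; first by exists r.
by move=> q /= [q0 tq]; apply: inverse_process_le => //; exact: le_lt_trans tq.
Qed.

(** Choose [r] below the inverse plus [e] with [s < D r w]. Every level in [[s, D r w[] is also
    exceeded at [r], so [dl] is the overshoot [D r w - s]. A path that never exceeds [s] gives 0 at
    all higher levels. *)
Lemma inverse_process_right_continuous s e : 0 < e ->
  exists2 dl, 0 < dl & forall s', s <= s' -> s' < s + dl ->
    inverse_process D s w <= inverse_process D s' w < inverse_process D s w + e.
Proof.
move=> e0; have [sx|out] := crosses_or_out s; last first.
  exists 1 => // s' ss' _; rewrite !inverse_process_out ?add0r ?lexx//.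
  by move=> r r0; apply: le_trans ss'; exact: out.
have [|r [r0 rx sr]] := @inverse_process_adherent s (inverse_process D s w + e) sx.
  by rewrite ltrDl.
exists (D r w - s); first by rewrite subr_gt0.
move=> s' ss' s'r; have {}s'r : s' < D r w by move: s'r; lra.
rewrite inverse_process_nd//=; last by exists r.
by apply: le_lt_trans rx; exact: inverse_process_le.
Qed.

Variable N : R -> T -> nat.
Hypothesis N_cadlag : cadlag (fun t => (N t w)%:R : R).
Hypothesis N_nd : forall s t, 0 <= s -> s <= t -> (N s w <= N t w)%N.

(** Integer values at distance less than 1 from the right limit coincide with it. *)
Lemma counting_right_constant y : 0 <= y ->
  exists2 e, 0 < e & forall x, y <= x -> x < y + e -> N x w = N y w.
Proof.
move=> y0; have /cvgrPdist_lt/(_ _ ltr01) := N_cadlag.1 _ y0.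
move=> [e/= e0 H]; exists e => // x; rewrite le_eqVlt => /predU1P[->//|yx xe].
have xye : `|y - x| < e by rewrite distrC gtr0_norm ?subr_gt0// ltrBlDl.
have := H x xye yx; rewrite ltr_distlC => /andP[_].
rewrite -[X in _ < _ + X]/(1%:R) -natrD ltr_nat addn1 ltnS => Nxy.
by apply/eqP; rewrite eqn_leq Nxy N_nd// ltW.
Qed.

Lemma time_changed_right_constant s :
  exists2 e, 0 < e & forall s', s <= s' -> s' < s + e ->
    time_changed N D s' w = time_changed N D s w.
Proof.
have [e e0 He] := counting_right_constant (inverse_process_ge0 s).
have [dl dl0 Hdl] := inverse_process_right_continuous s e0.
exists dl => // s' ss' /(Hdl _ ss')/andP[H1 H2]; exact: He.
Qed.

End inverse_paths.

(** * Measurability of the inverse and of the time change *)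

Section random_time.
Context d (T : measurableType d) (R : realType).
Variable D : R -> T -> R.
Hypothesis mD : forall t, 0 <= t -> measurable_fun setT (D t).
Hypothesis D_nd : forall w s t, 0 <= s -> s <= t -> D s w <= D t w.

Lemma measurable_crossing t s : 0 <= s -> measurable [set w | t < D s w].
Proof.
move=> s0; rewrite (_ : [set _ | _] = setT `&` D s @^-1` `]t, +oo[%classic).
  exact: mD.
by rewrite setTI; apply/seteqP; split => w /=; rewrite in_itv/= andbT.
Qed.

(** Integer times make this a countable intersection; for monotone paths they decide all times, by
    [never_crossingP]. *)
Lemma measurable_never_crossing t : measurable [set w | forall n : nat, D n%:R w <= t].
Proof.
rewrite (_ : [set _ | _] = \bigcap_(n : nat) ~` [set w | t < D n%:R w]).
  apply: bigcap_measurableType => n _; apply: measurableC.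
  exact: measurable_crossing.
apply/seteqP; split => w /= H n; last by rewrite leNgt; apply/negP; exact: H.
by move=> _ /=; rewrite ltNge H.
Qed.

Lemma never_crossingP w t : (forall n : nat, D n%:R w <= t) ->
  forall s, 0 <= s -> D s w <= t.
Proof.
move=> H s s0; apply: le_trans (H (Num.truncn s).+1); apply: D_nd => //.
by apply/ltW; exact: truncnS_gt.
Qed.

Lemma measurable_inverse_process t : measurable_fun setT (inverse_process D t).
Proof.
apply: (measurability _ (RGenInftyO.measurableE R)) => //.
move=> _ [_ [x ->] <-]; rewrite setTI.
have [x0|x0] := leP x 0.
  rewrite (_ : _ @^-1` _ = set0)//; apply/seteqP; split => // w /=.
  rewrite in_itv/= ltNge (le_trans x0)//; apply: inverse_process_ge0.
(* For [x > 0] the inverse is below [x] either by default or because the level is exceeded at some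
   rational time before [x]. *)
rewrite (_ : _ @^-1` _ = [set w | forall n : nat, D n%:R w <= t] `|`
   \bigcup_(q : rat) [set w | [/\ 0 <= ratr q :> R, ratr q < x & t < D (ratr q) w]]).
  apply: measurableU; first exact: measurable_never_crossing.
  apply: bigcupT_measurable_rat => q.
  have [q0|q0] := boolP (0 <= ratr q :> R); last first.
    by rewrite (_ : [set _ | _] = set0)//; apply/seteqP; split => // w [].
  have [qx|qx] := boolP (ratr q < x); last first.
    by rewrite (_ : [set _ | _] = set0)//; apply/seteqP; split => // w [].
  rewrite (_ : [set _ | _] = [set w | t < D (ratr q) w]); first exact: measurable_crossing.
  by apply/seteqP; split => w //=; case.
apply/seteqP; split => w /=; rewrite in_itv/=.
  move=> Yx; have [ex|out] := crosses_or_out D w t; [right|left => n; exact: out].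
  have [s [s0 sx ts]] := inverse_process_adherent ex Yx.
  have [q] := rat_in_itvoo sx; rewrite in_itv/= => /andP[sq qx].
  exists q => //; split => //; first by apply: le_trans (ltW sq).
  by apply: (lt_le_trans ts); rewrite D_nd// ltW.
move=> [/never_crossingP out|[q _ [q0 qx tq]]].
  by rewrite inverse_process_out// => s s0; exact: out.
by apply: le_lt_trans qx; exact: inverse_process_le.
Qed.

Variable N : R -> T -> nat.
Hypothesis mN : forall t, 0 <= t -> measurable_fun setT (fun w => (N t w)%:R : R).
Hypothesis N_cadlag : forall w, cadlag (fun t => (N t w)%:R : R).
Hypothesis N_nd : forall w s t, 0 <= s -> s <= t -> (N s w <= N t w)%N.

Lemma measurable_counting t (Q : set nat) : 0 <= t -> measurable [set w | Q (N t w)].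
Proof.
move=> t0; rewrite (_ : [set _ | _] = \bigcup_(k in Q) (setT `&`
  (fun w => (N t w)%:R : R) @^-1` [set (k%:R : R)])).
  by apply: bigcup_measurable => k _; exact: mN.
apply/seteqP; split => w /=.
  by move=> Qw; exists (N t w) => //; split.
by move=> [k Qk [_ /=]] /eqP; rewrite eqr_nat => /eqP ->.
Qed.

(** For downward closed [Q] the random time can be replaced by rationals to its right:
    right-constancy of [N] provides one with the same count, and monotonicity brings [Q] back from
    any of them. *)
Let measurable_time_changed_down t (Q : nat -> Prop) :
  (forall k l, (k <= l)%N -> Q l -> Q k) ->
  measurable [set w | Q (time_changed N D t w)].
Proof.
move=> Qdown.
have mY := @measurable_inverse_process t.
rewrite (_ : [set _ | _] = \bigcup_(q : rat)
  [set w | [/\ 0 <= ratr q :> R, inverse_process D t w < ratr q & Q (N (ratr q) w)]]).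
  apply: bigcupT_measurable_rat => q.
  have [q0|q0] := boolP (0 <= ratr q :> R); last first.
    by rewrite (_ : [set _ | _] = set0)//; apply/seteqP; split => // w [].
  rewrite (_ : [set _ | _] = (setT `&` inverse_process D t @^-1` `]-oo, ratr q[%classic)
      `&` [set w | Q (N (ratr q) w)]).
    by apply: measurableI; [exact: mY|exact: measurable_counting].
  by rewrite setTI; apply/seteqP; split => w /=; rewrite in_itv/=; [case|move=> [? ?]; split].
apply/seteqP; split => w /=.
  move=> Qw; have Y0 := inverse_process_ge0 D w t.
  have [e e0 He] := counting_right_constant (N_cadlag w) (N_nd w) Y0.
  have : inverse_process D t w < inverse_process D t w + e by rewrite ltrDl.
  move=> /rat_in_itvoo[q]; rewrite in_itv/= => /andP[q1 q2].
  exists q => //; split => //; first exact: le_trans Y0 (ltW q1).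
  by rewrite He// ltW.
move=> [q _ [q0 Yq Qq]]; apply: Qdown Qq; apply: N_nd; last exact: ltW.
exact: inverse_process_ge0.
Qed.

Lemma measurable_time_changed t k : measurable [set w | time_changed N D t w = k].
Proof.
rewrite (_ : [set _ | _] = [set w | (time_changed N D t w <= k)%N] `\`
  [set w | (time_changed N D t w < k)%N]).
  apply: measurableD; first apply: (@measurable_time_changed_down t (fun l => l <= k)%N).
    by move=> a b ab; exact: leq_trans.
  apply: (@measurable_time_changed_down t (fun l => l < k)%N).
  by move=> a b ab; exact: leq_ltn_trans.
apply/seteqP; split => w /=; first by move=> ->; rewrite leqnn ltnn.
by move=> [H1 /negP]; rewrite -leqNgt => H2; apply/eqP; rewrite eqn_leq H1.
Qed.

End random_time.

(** * Integrals of functions of integer-valued variables *)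

Section nat_valued.
Context d (T : measurableType d) (R : realType) (P : probability T R).
Implicit Types (h : T -> nat) (f : nat -> R).

Lemma measurable_fun_nat_valued h f : (forall k, measurable [set w | h w = k]) ->
  measurable_fun setT (fun w => f (h w)).
Proof.
move=> mh _ A mA; rewrite setTI.
rewrite (_ : _ @^-1` _ = \bigcup_(k in [set k | A (f k)]) [set w | h w = k]).
  by apply: bigcup_measurable => k _.
by apply/seteqP; split => w /=; [exists (h w)|move=> [k ? ->]].
Qed.

Lemma trivIset_nat_valued h (A : set T) :
  trivIset setT (fun k => A `&` [set w | h w = k]).
Proof. by move=> i j _ _ [w [[_ /= <-] [_ /= <-]]]. Qed.

Lemma bigcup_nat_valued h (A : set T) :
  \bigcup_k (A `&` [set w | h w = k]) = A.
Proof.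
by apply/seteqP; split => w /=; [move=> [k _ []]|exists (h w)].
Qed.

Lemma integral_nat_valued_in h f (A : set T) : measurable A ->
  (forall k, measurable [set w | h w = k]) -> (forall k, 0 <= f k) ->
  (\int[P]_(w in A) (f (h w))%:E
   = \sum_(k <oo) (f k)%:E * P (A `&` [set w | h w = k]))%E.
Proof.
move=> mA mh f0.
have mAk k : measurable (A `&` [set w | h w = k]) by exact: measurableI.
rewrite -{1}(bigcup_nat_valued h A) ge0_integral_bigcup//; last 3 first.
- rewrite bigcup_nat_valued; apply/measurable_EFinP.
  by apply: measurable_funTS; exact: measurable_fun_nat_valued.
- by move=> w _; rewrite lee_fin.
- exact: trivIset_nat_valued.
apply: eq_eseriesr => k _.
rewrite -integral_cst//; apply: eq_integral => w.
by rewrite inE => -[_ /= ->].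
Qed.

Lemma integral_nat_valued h f :
  (forall k, measurable [set w | h w = k]) -> (forall k, 0 <= f k) ->
  (\int[P]_w (f (h w))%:E = \sum_(k <oo) (f k)%:E * P [set w | h w = k])%E.
Proof.
move=> mh f0; rewrite integral_nat_valued_in//.
by apply: eq_eseriesr => k _; rewrite setTI.
Qed.

(** A conditioning formula for a countable index: on each event [J w = j] the integrand is that of
    the fixed [G j], so independence of [J] from each single [G j] is all that enters. *)
Lemma integral_random_index (J : T -> nat) (G : nat -> T -> nat) f :
  (forall j, measurable [set w | J w = j]) ->
  (forall j k, measurable [set w | G j w = k]) ->
  (forall j k, P ([set w | J w = j] `&` [set w | G j w = k])
     = (P [set w | J w = j] * P [set w | G j w = k])%E) ->
  (forall k, 0 <= f k) ->
  (\int[P]_w (f (G (J w) w))%:E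
   = \sum_(j <oo) P [set w | J w = j] * \int[P]_w (f (G j w))%:E)%E.
Proof.
move=> mJ mG ind f0.
have mGJ k : measurable [set w | G (J w) w = k].
  rewrite (_ : [set _ | _] = \bigcup_j ([set w | J w = j] `&` [set w | G j w = k])).
    by apply: bigcupT_measurable => j; exact: measurableI.
  by apply/seteqP; split => w /=; [exists (J w)|move=> [j _ [/= -> ->]]].
have mJ' j : measurable ([set: T] `&` [set w | J w = j]) by rewrite setTI.
rewrite -{1}(bigcup_nat_valued J setT) ge0_integral_bigcup//; last 3 first.
- rewrite bigcup_nat_valued; apply/measurable_EFinP.
  exact: (measurable_fun_nat_valued (h := fun w => G (J w) w)).
- by move=> w _; rewrite lee_fin.
- exact: trivIset_nat_valued.
apply: eq_eseriesr => j _; rewrite setTI.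
transitivity (\int[P]_(w in [set w | J w = j]) (f (G j w))%:E)%E.
  by apply: eq_integral => w; rewrite inE /= => ->.
rewrite integral_nat_valued_in// integral_nat_valued//.
have [q qE] : exists q : R, P [set w | J w = j] = q%:E.
  by exists (fine (P [set w | J w = j])); rewrite fineK// fin_num_measure.
rewrite qE -nneseriesZl; last by move=> k _; rewrite mule_ge0// lee_fin.
by apply: eq_eseriesr => k _; rewrite ind qE muleCA.
Qed.

End nat_valued.

(** * Generating function and mean of the Poisson law *)

Section poisson_series.
Context {R : realType}.
Implicit Types x z : R.

Lemma expR_nneseries x : 0 <= x ->
  (\sum_(k <oo) (x ^+ k / k`!%:R)%:E = (expR x)%:E)%E.
Proof.
move=> x0; apply/cvg_lim => //.
rewrite (_ : (fun n => _) = EFin \o series (exp_coeff x)).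
  apply/cvg_EFin; [by near=> n|].
  exact: is_cvg_series_exp_coeff.
by apply/funext => n; rewrite /series/= -sumEFin.
Unshelve. all: by end_near. Qed.

Lemma poisson_pgf x z : 0 <= x -> 0 <= z ->
  (\sum_(k <oo) (z ^+ k)%:E * (expR (- x) * x ^+ k / k`!%:R)%:E
   = (expR (x * (z - 1)))%:E)%E.
Proof.
move=> x0 z0.
transitivity (\sum_(k <oo) (expR (- x))%:E * ((z * x) ^+ k / k`!%:R)%:E)%E.
  by apply: eq_eseriesr => k _; rewrite -!EFinM exprMn; congr EFin; ring.
rewrite nneseriesZl; last first.
  by move=> k _; rewrite lee_fin divr_ge0// exprn_ge0// mulr_ge0.
rewrite expR_nneseries ?mulr_ge0// -EFinM -expRD; congr (expR _)%:E; ring.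
Qed.

Lemma poisson_mean x : 0 <= x ->
  (\sum_(k <oo) (k%:R)%:E * (expR (- x) * x ^+ k / k`!%:R)%:E = x%:E)%E.
Proof.
move=> x0.
have p0 k : (0 <= (k%:R)%:E * (expR (- x) * x ^+ k / k`!%:R)%:E)%E.
  by rewrite -EFinM lee_fin !mulr_ge0// ?expR_ge0 ?exprn_ge0 ?invr_ge0.
rewrite nneseries_recl// mul0e add0e.
rewrite -(@nneseries_addn _ _ 1)//.
(* After the index shift, [k.+1] cancels in the factorial and leaves [x] times the generating
   function at 1. *)
transitivity (\sum_(k <oo) x%:E * ((1 ^+ k)%:E * (expR (- x) * x ^+ k / k`!%:R)%:E))%E.
  apply: eq_eseriesr => k _; rewrite addn1 -!EFinM; congr EFin.
  rewrite expr1n exprS factS natrM; field.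
  by rewrite nat1r !pnatr_eq0/= -lt0n fact_gt0.
rewrite nneseriesZl; last first.
  by move=> k _; rewrite -EFinM lee_fin !mulr_ge0// ?expR_ge0 ?exprn_ge0 ?invr_ge0.
by rewrite poisson_pgf// subrr mulr0 expR0 mule1.
Qed.

End poisson_series.

(** * The time-changed Poisson process *)

Section time_changed_poisson.
Context d (T : measurableType d) (R : realType) (P : probability T R).
Variables (a1 a2 lambda C1 C2 : R).
Hypotheses (hlambda : 0 < lambda) (hC : C1 + C2 = 1).
Variable D : R -> T -> R.
Hypothesis hD : mixed_stable_subordinator P a1 a2 C1 C2 D.
Variable N : R -> T -> nat.
Hypothesis hN : poisson_process P lambda N.
Hypothesis hND : independent_classes P
  (sigma_generated [set t | 0 <= t] N)
  (sigma_generated [set t | 0 <= t] (inverse_process D)).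

Lemma mixed_stable_measurable s : 0 <= s -> measurable_fun setT (D s).
Proof. by move: s; exact: levy_measurable hD.1.1. Qed.

Lemma mixed_stable_nd w s t : 0 <= s -> s <= t -> D s w <= D t w.
Proof. exact: hD.1.2. Qed.

Lemma poisson_measurable s : 0 <= s -> measurable_fun setT (fun w => (N s w)%:R : R).
Proof. by case: hN => hL _ _; move: s; exact: levy_measurable hL. Qed.

Lemma poisson_cadlag w : cadlag (fun t => (N t w)%:R : R).
Proof. by case: hN => hL _ _; exact: levy_cadlag hL w. Qed.

Lemma poisson_nd w s t : 0 <= s -> s <= t -> (N s w <= N t w)%N.
Proof. by case: hN => _ + _; exact. Qed.

Lemma measurable_poisson_eq s k : 0 <= s -> measurable [set w | N s w = k].
Proof. by move=> s0; exact: (measurable_counting poisson_measurable [set k] s0). Qed.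

Lemma poisson_expectation s : 0 <= s ->
  (\int[P]_w ((N s w)%:R)%:E = (lambda * s)%:E)%E.
Proof.
move=> s0; rewrite (integral_nat_valued P (h := N s) (f := fun k => k%:R))//; last first.
  by move=> k; exact: measurable_poisson_eq.
rewrite -[RHS]poisson_mean; last by rewrite mulr_ge0// ltW.
by case: hN => _ _ hP; apply: eq_eseriesr => k _; rewrite hP.
Qed.

Lemma poisson_expectation_exp s z : 0 <= s -> 0 <= z ->
  (\int[P]_w (z ^+ N s w)%:E = (expR (lambda * s * (z - 1)))%:E)%E.
Proof.
move=> s0 z0; rewrite (integral_nat_valued P (h := N s) (f := fun k => z ^+ k))//; last 2 first.
- by move=> k; exact: measurable_poisson_eq.
- by move=> k; exact: exprn_ge0.
rewrite -poisson_pgf//; last by rewrite mulr_ge0// ltW.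
by case: hN => _ _ hP; apply: eq_eseriesr => k _; rewrite hP.
Qed.

(* Markov's inequality at [s = 1], where the Laplace exponent equals
   [C1 + C2 = 1]. *)
Lemma mixed_stable_le_prob s t : 0 <= s ->
  (P [set w | (D s w <= t)%R] <= (expR (t - s))%:E)%E.
Proof.
move=> s0; have := hD.2 s 1 s0 ler01; rewrite !powR1 !mulr1 hC mulr1 unlock => HE.
have mDs := mixed_stable_measurable s0.
have mS : measurable [set w | D s w <= t].
  rewrite (_ : [set _ | _] = setT `&` D s @^-1` `]-oo, t]%classic); first exact: mDs.
  by rewrite setTI; apply/seteqP; split => w /=; rewrite in_itv.
have mE : measurable_fun setT (fun w => expR (- 1 * D s w)).
  by apply: measurableT_comp => //; apply: measurable_funM.
rewrite expRD EFinM -HE -ge0_integralZl//; last exact/measurable_EFinP.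
rewrite -[X in P X]setIT -integral_indic//.
apply: ge0_le_integral => //.
- by apply/measurable_EFinP; exact: measurable_indic.
- by apply: measurable_funeM; exact/measurable_EFinP.
move=> w _; rewrite -EFinM lee_fin -expRD indicE.
case: (boolP (w \in _)) => [|_]; last exact: expR_ge0.
by rewrite inE/= => Dt; rewrite -[leLHS]expR0 ler_expR; lra.
Qed.

Lemma mixed_stable_never_crossing t : P [set w | forall n : nat, D n%:R w <= t] = 0%E.
Proof.
apply/eqP; rewrite eq_le measure_ge0 andbT.
apply/lee_addgt0Pr => e e0; rewrite add0e.
(* With [expR t / e < n <= expR n], the Chernoff bound at time [n] is at most [e]. *)
pose n := (Num.truncn (expR t / e)).+1.
have ten : expR t / e < n%:R by exact: truncnS_gt.
apply: (@le_trans _ _ (expR (t - n%:R))%:E).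
  apply: le_trans (@mixed_stable_le_prob n%:R t _) => //.
  rewrite le_measure ?inE//.
  - apply: measurable_never_crossing; exact: mixed_stable_measurable.
  - have := measurable_crossing mixed_stable_measurable t (ler0n R n).
    move/measurableC; congr (measurable _).
    by apply/seteqP; split => w /=; rewrite leNgt => /negP.
  - by move=> w /= H; exact: H.
rewrite lee_fin expRD expRN ler_pdivrMr ?expR_gt0// mulrC -ler_pdivrMr//.
apply/ltW/(lt_le_trans ten); apply: le_trans (expR_ge1Dx _); lra.
Qed.

(** The value 0 arises either by default, on the null event of no crossing, or from [t < D x w] for
    all [x > 0], which right-continuity at 0 excludes when [D 0 w = 0]. *)
Lemma inverse_process_eq0_null t : 0 < t ->
  P [set w | inverse_process D t w = 0] = 0%E.
Proof.
move=> t0.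
have mY := measurable_inverse_process mixed_stable_measurable mixed_stable_nd t.
have mD0 := mixed_stable_measurable (lexx 0).
have mZ : measurable [set w | D 0 w = 0].
  rewrite (_ : [set _ | _] = setT `&` D 0 @^-1` [set 0]); first exact: mD0.
  by rewrite setTI.
apply: measure_negligible.
  rewrite (_ : [set _ | _] = setT `&` inverse_process D t @^-1` [set 0]); first exact: mY.
  by rewrite setTI.
apply: (@negligibleS _ _ _ _
  ([set w | forall n : nat, D n%:R w <= t] `|` ~` [set w | D 0 w = 0])); last first.
  apply: negligibleU.
    apply/negligibleP; last exact: mixed_stable_never_crossing.
    by apply: measurable_never_crossing; exact: mixed_stable_measurable.
  apply/negligibleP; first exact: measurableC.
  by rewrite [LHS](probability_setC P mZ) (levy_start hD.1.1) subee.
move=> w /= Y0; have [ex|out] := crosses_or_out D w t; last by left=> n; exact: out.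
right=> D00.
have : D x w @[x --> 0^'+] --> D 0 w by apply: (levy_cadlag hD.1.1 w).1.
rewrite D00 => /cvgrPdist_lt/(_ _ t0)[e/= e0 /(_ (e / 2))].
have e20 : 0 < e / 2 by rewrite divr_gt0.
rewrite /= sub0r normrN (gtr0_norm e20).
move=> /(_ ltac:(lra) ltac:(lra)); rewrite sub0r normrN ltr_norml => /andP[_].
apply/negP; rewrite -leNgt; apply/ltW/inverse_process_crosses => //.
  by move=> *; exact: mixed_stable_nd.
by rewrite Y0; lra.
Qed.

Variable t : R.
Hypothesis t0 : 0 < t.
Let Y := inverse_process D t.
Let M := time_changed N D t.
(** The index of the cell of mesh [1 / n] containing [Y w]. It takes countably many values and is a
    function of [Y], so [hND] applies to it cell by cell. *)
Let grid n w := Num.truncn (Y w * n%:R).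

Let Y_ge0 w : 0 <= Y w. Proof. exact: inverse_process_ge0. Qed.

Let mY : measurable_fun setT Y.
Proof. exact: measurable_inverse_process mixed_stable_measurable mixed_stable_nd t. Qed.

Let grid_le n w : (0 < n)%N -> (grid n w)%:R / n%:R <= Y w.
Proof.
move=> n0; rewrite ler_pdivrMr ?ltr0n//.
by have /andP[] := truncn_itv (mulr_ge0 (Y_ge0 w) (ler0n R n)).
Qed.

Let grid_gt n w : (0 < n)%N -> Y w <= (grid n w).+1%:R / n%:R.
Proof.
by move=> n0; rewrite ler_pdivlMr ?ltr0n//; apply/ltW; exact: truncnS_gt.
Qed.

Let gridE n j : (0 < n)%N ->
  [set w | grid n w = j] = Y @^-1` `[j%:R / n%:R, j.+1%:R / n%:R[%classic.
Proof.
move=> n0; apply/seteqP; split => w /=; rewrite in_itv/=.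
  move=> <-; rewrite grid_le//= ltr_pdivlMr ?ltr0n//; exact: truncnS_gt.
rewrite ler_pdivrMr ?ltr0n// ltr_pdivlMr ?ltr0n// => H.
exact: truncn_def.
Qed.

Let measurable_grid n j : (0 < n)%N -> measurable [set w | grid n w = j].
Proof. by move=> n0; rewrite gridE// -[X in measurable X]setTI; exact: mY. Qed.

Let grid_poisson_indep n j s k : (0 < n)%N -> 0 <= s ->
  P ([set w | grid n w = j] `&` [set w | N s w = k])
  = (P [set w | grid n w = j] * P [set w | N s w = k])%E.
Proof.
move=> n0 s0; rewrite setIC muleC; apply: hND.
  apply: sub_sigma_algebra; exists s => //; exists [set k] => //.
  by rewrite setTI.
rewrite gridE//; apply: sub_sigma_algebra; exists t; first exact: ltW.
by eexists; [|by rewrite setTI; reflexivity].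
Qed.

(** [g] is later the identity or the successor, selecting the lower or the upper end of the cell. *)
Let grid_expectation n (g : nat -> nat) (f : nat -> R) : (0 < n)%N ->
  (forall k, 0 <= f k) ->
  (\int[P]_w (f (N ((g (grid n w))%:R / n%:R) w))%:E
   = \sum_(j <oo) P [set w | grid n w = j] * \int[P]_w (f (N ((g j)%:R / n%:R) w))%:E)%E.
Proof.
move=> n0 f0.
have gn j : 0 <= (g j)%:R / n%:R :> R by rewrite divr_ge0.
apply: (integral_random_index (G := fun j => N ((g j)%:R / n%:R))) => //.
- by move=> j; exact: measurable_grid.
- by move=> j k; exact: measurable_poisson_eq.
- by move=> j k; exact: grid_poisson_indep.
Qed.

Let measurable_M k : measurable [set w | M w = k].
Proof.
exact: (measurable_time_changed mixed_stable_measurable mixed_stable_nd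
  poisson_measurable poisson_cadlag poisson_nd).
Qed.

Let measurable_grid_N n g k : (0 < n)%N ->
  measurable [set w | N ((g (grid n w))%:R / n%:R) w = k].
Proof.
move=> n0; rewrite (_ : [set _ | _] = \bigcup_j ([set w | grid n w = j] `&`
    [set w | N ((g j)%:R / n%:R) w = k])).
  apply: bigcupT_measurable => j; apply: measurableI; first exact: measurable_grid.
  by apply: measurable_poisson_eq; rewrite divr_ge0.
by apply/seteqP; split => w /=; [exists (grid n w)|move=> [j _ [/= -> ->]]].
Qed.

Let grid_mean n (g : nat -> nat) : (0 < n)%N ->
  (\int[P]_w ((N ((g (grid n w))%:R / n%:R) w)%:R)%:E
   = \int[P]_w (lambda * ((g (grid n w))%:R / n%:R))%:E)%E.
Proof.
move=> n0; rewrite (grid_expectation g (f := fun k => k%:R))//.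
rewrite (integral_nat_valued P (h := grid n)
  (f := fun j => lambda * ((g j)%:R / n%:R)))//; last 2 first.
- by move=> k; exact: measurable_grid.
- by move=> k; rewrite mulr_ge0// ?ltW// divr_ge0.
by apply: eq_eseriesr => j _; rewrite poisson_expectation ?divr_ge0// muleC.
Qed.

Let integral_Y_scale : (\int[P]_w (lambda * Y w)%:E = lambda%:E * \int[P]_w (Y w)%:E)%E.
Proof.
under eq_integral do rewrite EFinM.
rewrite ge0_integralZl ?lee_fin ?(ltW hlambda)//; first exact/measurable_EFinP.
by move=> w _; rewrite lee_fin.
Qed.

Let measurable_grid_fun n (f : nat -> R) : (0 < n)%N ->
  measurable_fun setT (fun w => (f (grid n w))%:E).
Proof.
move=> n0; apply/measurable_EFinP; apply: measurable_fun_nat_valued => k.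
exact: measurable_grid.
Qed.

Let measurable_M_fun (f : nat -> R) : measurable_fun setT (fun w => (f (M w))%:E).
Proof.
by apply/measurable_EFinP; apply: measurable_fun_nat_valued => k.
Qed.

Let measurable_grid_N_fun n g (f : nat -> R) : (0 < n)%N ->
  measurable_fun setT (fun w => (f (N ((g (grid n w))%:R / n%:R) w))%:E).
Proof.
move=> n0; apply/measurable_EFinP.
apply: (measurable_fun_nat_valued (h := fun w => N ((g (grid n w))%:R / n%:R) w)) => k.
exact: measurable_grid_N.
Qed.

Let lower_mean n : (0 < n)%N ->
  (\int[P]_w (lambda * ((grid n w)%:R / n%:R))%:E <= \int[P]_w ((M w)%:R)%:E)%E.
Proof.
move=> n0; rewrite -(grid_mean id n0); apply: ge0_le_integral => //.
- exact: (measurable_grid_N_fun id (fun k => k%:R)).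
- move=> w _; rewrite lee_fin ler_nat; apply: (poisson_nd w); last exact: grid_le.
  by rewrite divr_ge0.
Qed.

Let upper_mean n : (0 < n)%N ->
  (\int[P]_w ((M w)%:R)%:E <= \int[P]_w (lambda * ((grid n w).+1%:R / n%:R))%:E)%E.
Proof.
move=> n0; rewrite -(grid_mean S n0); apply: ge0_le_integral => //.
- exact: (measurable_grid_N_fun S (fun k => k%:R)).
- move=> w _; rewrite lee_fin ler_nat; apply: (poisson_nd w) => //.
  exact: grid_gt.
Qed.

Let grid_shift n : (0 < n)%N ->
  (\int[P]_w (lambda * ((grid n w).+1%:R / n%:R))%:E
   = \int[P]_w (lambda * ((grid n w)%:R / n%:R))%:E + (lambda / n%:R)%:E)%E.
Proof.
move=> n0; transitivity
  (\int[P]_w ((lambda * ((grid n w)%:R / n%:R))%:E + (lambda / n%:R)%:E))%E.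
  apply: eq_integral => w _; rewrite -EFinD; congr EFin.
  by rewrite -natr1 mulrDl mulrDr mul1r.
rewrite ge0_integralD//.
- congr (_ + _)%E.
  by rewrite integral_cst// -[RHS]mule1; congr (_ * _)%E; exact: probability_setT.
- by move=> w _; rewrite lee_fin mulr_ge0 ?(ltW hlambda)// divr_ge0.
- exact: (measurable_grid_fun (fun k => lambda * (k%:R / n%:R))).
- by move=> w _; rewrite lee_fin divr_ge0// ltW.
Qed.

Let measurable_lambdaY : measurable_fun setT (fun w => (lambda * Y w)%:E).
Proof. by apply/measurable_EFinP; exact: measurable_funM. Qed.

(* Both sides lie within [lambda / n] of [lambda] times the mean of [Y] rounded
   down to the grid of mesh [1 / n]. *)
Lemma time_changed_mean :
  (\int[P]_w ((M w)%:R)%:E = lambda%:E * \int[P]_w (Y w)%:E)%E.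
Proof.
rewrite -integral_Y_scale.
have eps e : 0 < e -> exists2 n, (0 < n)%N & lambda / n%:R <= e.
  move=> e0; exists (Num.truncn (lambda / e)).+1 => //.
  rewrite ler_pdivrMr// mulrC -ler_pdivrMr//; apply/ltW; exact: truncnS_gt.
have le1 n : (0 < n)%N -> (\int[P]_w (lambda * ((grid n w)%:R / n%:R))%:E
    <= \int[P]_w (lambda * Y w)%:E)%E.
  move=> n0; apply: ge0_le_integral => //.
  - by move=> w _; rewrite lee_fin mulr_ge0 ?(ltW hlambda)// divr_ge0.
  - exact: (measurable_grid_fun (fun k => lambda * (k%:R / n%:R))).
  - move=> w _; rewrite lee_fin ler_pM2l//; exact: grid_le.
have le2 n : (0 < n)%N -> (\int[P]_w (lambda * Y w)%:E
    <= \int[P]_w (lambda * ((grid n w).+1%:R / n%:R))%:E)%E.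
  move=> n0; apply: ge0_le_integral => //.
  - by move=> w _; rewrite lee_fin mulr_ge0 ?(ltW hlambda).
  - exact: (measurable_grid_fun (fun k => lambda * (k.+1%:R / n%:R))).
  - move=> w _; rewrite lee_fin ler_pM2l//; exact: grid_gt.
apply/eqP; rewrite eq_le; apply/andP; split; apply/lee_addgt0Pr => e e0;
  have [n n0 ne] := eps e e0.
  apply: (le_trans (upper_mean n0)); rewrite grid_shift//.
  by apply: leeD; [exact: le1|rewrite lee_fin].
apply: (le_trans (le2 _ n0)); rewrite grid_shift//.
by apply: leeD; [exact: lower_mean|rewrite lee_fin].
Qed.

Let grid1_prob j : (P [set w | grid 1 w = j] <= (expR (t + 1 - j%:R))%:E)%E.
Proof.
have n0 : (0 < 1)%N by [].
case: j => [|j].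
  apply: (@le_trans _ _ 1%E).
    by apply: probability_le1; exact: measurable_grid.
  rewrite lee_fin subr0; apply: le_trans (expR_ge1Dx (t + 1)).
  by rewrite lerDl addr_ge0// ltW.
(* Only a strict inequality [j < Y w] yields [D j w <= t], so one unit of the index is lost; this is
   the 1 in the exponent. *)
rewrite (_ : t + 1 - j.+1%:R = t - j%:R); last by rewrite -natr1; ring.
apply: le_trans (@mixed_stable_le_prob j%:R t (ler0n _ _)).
rewrite le_measure ?inE//; first exact: measurable_grid.
  have := measurable_crossing mixed_stable_measurable t (ler0n R j).
  move/measurableC; congr (measurable _).
  by apply/seteqP; split => w /=; rewrite leNgt => /negP.
move=> w /= wj; apply: inverse_process_gt; first exact: ler0n.
have := grid_le w n0; rewrite wj divr1; apply: lt_le_trans.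
by rewrite ltr_nat.
Qed.

(** The weight grows at half the rate at which [grid1_prob] decays, which leaves a geometric series
    of ratio [expR (- (1 / 2))]. *)
Let grid1_exp : (\sum_(j <oo) P [set w | grid 1 w = j] * (expR (j.+1%:R / 2))%:E < +oo)%E.
Proof.
apply: (@le_lt_trans _ _ (\sum_(j <oo) (expR (t + 1 + 1 / 2))%:E * (expR (- (1 / 2)) ^+ j)%:E)%E).
  apply: lee_nneseries => [j _ _|j _].
    by rewrite mule_ge0// lee_fin expR_ge0.
  apply: (@le_trans _ _ ((expR (t + 1 - j%:R))%:E * (expR (j.+1%:R / 2))%:E)%E).
    by apply: lee_wpmul2r => //; rewrite lee_fin expR_ge0.
  rewrite -!EFinM -expRM_natl -!expRD lee_fin ler_expR -natr1; lra.
rewrite nneseriesZl; last by move=> j _; rewrite lee_fin exprn_ge0// expR_ge0.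
rewrite lte_mul_pinfty ?lee_fin ?expR_ge0//.
have q1 : `|expR (- (1 / 2)) : R| < 1.
  by rewrite ger0_norm ?expR_ge0// -expR0 ltr_expR; lra.
rewrite (_ : (\sum_(j <oo) _)%E = ((1 - expR (- (1 / 2)))^-1)%:E) ?ltry//.
apply/cvg_lim => //.
rewrite (_ : (fun n => _) = EFin \o series (geometric 1 (expR (- (1 / 2))))).
  apply/cvg_EFin; first by near=> n.
  by rewrite -[X in _ --> X]mul1r; exact: cvg_geometric_series.
apply/funext => n; rewrite /series/= -sumEFin; apply: eq_bigr => j _.
by rewrite [X in _ = X%:E]mul1r.
Unshelve. all: by end_near. Qed.

Lemma inverse_process_expectation_lty : (\int[P]_w (Y w)%:E < +oo)%E.
Proof.
have n0 : (0 < 1)%N by [].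
(* By [x <= 2 * expR (x / 2)] at the upper end of the cell, the mean reduces to [grid1_exp]. *)
apply: (@le_lt_trans _ _ (\int[P]_w (2 * expR ((grid 1 w).+1%:R / 2))%:E)%E).
  apply: ge0_le_integral => //.
  - by move=> w _; rewrite lee_fin.
  - exact/measurable_EFinP.
  - exact: (measurable_grid_fun (fun k => 2 * expR (k.+1%:R / 2))).
  - move=> w _; rewrite lee_fin; have := grid_gt w n0; rewrite divr1 => /le_trans; apply.
    by have := expR_ge1Dx ((grid 1 w).+1%:R / 2 : R); lra.
rewrite (integral_nat_valued P (h := grid 1) (f := fun k => 2 * expR (k.+1%:R / 2)))//; last first.
  by move=> k; exact: measurable_grid.
under eq_eseriesr do rewrite EFinM -muleA [(_ * P _)%E]muleC.
rewrite nneseriesZl; last by move=> k _; rewrite mule_ge0// lee_fin expR_ge0.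
by rewrite lte_mul_pinfty// lee_fin.
Qed.

(** Makes the normalizing constant of the asymptotics nonzero. A zero integral would put the whole
    space into a null set together with the null event [Y w = 0]. *)
Lemma inverse_process_expectation_gt0 : (0 < \int[P]_w (Y w)%:E)%E.
Proof.
rewrite lt0e integral_ge0 ?andbT; last by move=> w _; rewrite lee_fin.
apply/eqP => Y0.
have mYE : measurable_fun setT (fun w => (Y w)%:E) by exact/measurable_EFinP.
have /(ae_eq_integral_abs P measurableT mYE)[Z [mZ Z0 subZ]] :
    (\int[P]_w `|(Y w)%:E| = 0)%E.
  by rewrite -Y0; apply: eq_integral => w _; rewrite gee0_abs// lee_fin.
have : (P setT <= 0)%E; last by rewrite probability_setT lee_fin ler10.
have mY0 : measurable [set w | Y w = 0].
  rewrite (_ : [set _ | _] = setT `&` Y @^-1` [set 0]); first exact: mY.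
  by rewrite setTI.
rewrite -[X in (_ <= X)%E]adde0 -{1}Z0 -(inverse_process_eq0_null t0).
apply: le_trans (measureU2 _ mZ mY0).
rewrite le_measure ?inE//; first exact: measurableU.
move=> w _; have [?|Yw] := pselect (Y w = 0); [by right|left; apply: subZ => /= H].
by apply: Yw; have := H I => -[].
Qed.

(* With this base the grid cell [j] contributes [expR (j.+1 / 2)], while its
   probability is at most [expR (t + 1 - j)]. *)
Lemma time_changed_exp_moment :
  (\sum_(k <oo) ((1 + (2 * lambda)^-1) ^+ k)%:E * P [set w | M w = k] < +oo)%E.
Proof.
set z := 1 + _; have n0 : (0 < 1)%N by [].
have l2 : 0 < (2 * lambda)^-1 by rewrite invr_gt0 mulr_gt0.
have z1 : 1 <= z by rewrite /z; lra.
have z0 : 0 <= z by lra.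
rewrite -(integral_nat_valued P (h := M) (f := fun k => z ^+ k))//; last first.
  by move=> k; exact: exprn_ge0.
apply: le_lt_trans grid1_exp.
apply: (@le_trans _ _ (\int[P]_w (z ^+ N ((grid 1 w).+1%:R / 1%:R) w)%:E)%E).
  apply: ge0_le_integral => //.
  - by move=> w _; rewrite lee_fin exprn_ge0.
  - exact: (measurable_grid_N_fun S (fun k => z ^+ k)).
  - move=> w _; rewrite lee_fin ler_weXn2l//; apply: (poisson_nd w) => //.
    exact: grid_gt.
rewrite (grid_expectation S (f := fun k => z ^+ k))//; last first.
  by move=> k; exact: exprn_ge0.
apply: lee_nneseries => [j _ _|j _].
  by rewrite mule_ge0// integral_ge0// => w _; rewrite lee_fin exprn_ge0.
rewrite poisson_expectation_exp ?divr_ge0//.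
rewrite divr1 (_ : lambda * j.+1%:R * (z - 1) = j.+1%:R / 2)//.
by rewrite /z; field; rewrite gt_eqF.
Qed.

End time_changed_poisson.

(** * Ruin probabilities *)

Section sigma_generated_sums.
Context d (T : measurableType d) (R : realType) (P : probability T R).
Variable X : nat -> {RV P >-> R}.

(** [hXM] speaks of the sigma-algebra generated by the claims, so measurability in [T] is not enough
    to apply it to events about partial sums. *)
Lemma partial_sum_sigma_generated n x :
  sigma_generated setT X [set w | x < partial_sum X n w].
Proof.
rewrite /sigma_generated; set G := \bigcup_(i in _) _.
have mX i y : <<s G >> [set w | y < X i w].
  apply: sub_sigma_algebra; exists i => //; exists `]y, +oo[%classic => //.
  by rewrite setTI; apply/seteqP; split => w /=; rewrite in_itv/= andbT.
have sI A B : <<s G >> A -> <<s G >> B -> <<s G >> (A `&` B).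
  move=> mA mB.
  exact: (@measurableI _ (g_sigma_algebraType G) A B mA mB).
elim: n x => [|n IH] x.
  have [x0|x0] := ltP x 0.
    rewrite (_ : [set w | _] = setT).
      exact: (@measurableT _ (g_sigma_algebraType G)).
    by apply/seteqP; split => // w _ /=; rewrite partial_sumE big_ord0.
  rewrite (_ : [set w | _] = set0).
    exact: (@measurable0 _ (g_sigma_algebraType G)).
  by apply/seteqP; split => // w /=; rewrite partial_sumE big_ord0 ltNge x0.
rewrite (_ : [set w | _] = \bigcup_(q : rat)
    ([set w | ratr q < partial_sum X n w] `&` [set w | x - ratr q < X n w])).
  apply: (@bigcupT_measurable_rat _ (g_sigma_algebraType G)) => q.
  exact: sI.
apply/seteqP; split => w /=; rewrite partial_sumS.
  move=> xs; have : x - X n w < partial_sum X n w by lra.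
  move=> /rat_in_itvoo[q]; rewrite in_itv/= => /andP[q1 q2].
  by exists q => //; split => //=; lra.
by move=> [q _ [/= q1 q2]]; lra.
Qed.

End sigma_generated_sums.

Section ruin_event.
Context d (T : measurableType d) (R : realType) (P : probability T R).
Variables (a1 a2 lambda C1 C2 c : R).
Hypotheses (hlambda : 0 < lambda) (hC : C1 + C2 = 1) (hc : 0 < c).
Variable D : R -> T -> R.
Hypothesis hD : mixed_stable_subordinator P a1 a2 C1 C2 D.
Variable N : R -> T -> nat.
Hypothesis hN : poisson_process P lambda N.
Variable X : nat -> {RV P >-> R}.
Hypothesis hXpos : forall i, P [set w | 0 < X i w] = 1%E.
Hypothesis hXiid : iid P X.
Hypothesis hXM : independent_classes P
  (sigma_generated setT X)
  (sigma_generated [set t | 0 <= t] (time_changed N D)).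

Let M := time_changed N D.

Let measurable_M s k : measurable [set w | M s w = k].
Proof.
exact: (measurable_time_changed (mixed_stable_measurable hD) (mixed_stable_nd hD)
  (poisson_measurable hN) (poisson_cadlag hN) (poisson_nd hN)).
Qed.

Definition random_sum_gt s x : set T := [set w | x < partial_sum X (M s w) w].

Let random_sum_gtE s x : random_sum_gt s x =
  \bigcup_k ([set w | x < partial_sum X k w] `&` [set w | M s w = k]).
Proof.
apply/seteqP; split => w /=; first by move=> H; exists (M s w).
by move=> [k _ [H Mk]]; rewrite /random_sum_gt/= Mk.
Qed.

Lemma measurable_random_sum_gt s x : measurable (random_sum_gt s x).
Proof.
rewrite random_sum_gtE; apply: bigcupT_measurable => k.
by apply: measurableI => //; exact: measurable_rv_gt.
Qed.

Lemma random_sum_gt_series s x : 0 <= s ->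
  P (random_sum_gt s x) = (\sum_(k <oo)
    (fine (P [set w | M s w = k]) * tail (distribution P (partial_sum X k)) x)%:E)%E.
Proof.
move=> s0; rewrite random_sum_gtE measure_semi_bigcup; first last.
- by rewrite -random_sum_gtE; exact: measurable_random_sum_gt.
- by move=> i j _ _ [w [[_ /= <-] [_ /= <-]]].
- by move=> k; apply: measurableI => //; exact: measurable_rv_gt.
apply: eq_eseriesr => k _.
transitivity (P [set w | (x < partial_sum X k w)%R] * P [set w | M s w = k])%E.
  apply: hXM; first exact: partial_sum_sigma_generated.
  apply: sub_sigma_algebra; exists s => //; exists [set k] => //.
  by rewrite setTI.
by rewrite EFinM tail_distributionE fineK ?fin_num_measure// muleC.
Qed.

Definition ruin_event t u : set T :=
  [set w | exists2 s, 0 <= s <= t & risk_process u c M X s w < 0].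

Let risk_lt0 u s w :
  (risk_process u c M X s w < 0) = (u + c * s < partial_sum X (M s w) w).
Proof. by rewrite /risk_process partial_sumE subr_lt0. Qed.

(* The risk process is right-continuous, so ruin before [t] can be observed at
   a rational time or at [t]. *)
Lemma measurable_ruin_event t u : 0 <= t -> measurable (ruin_event t u).
Proof.
move=> t0; pose F (q : rat) := if 0 <= (ratr q : R) <= t
  then random_sum_gt (ratr q) (u + c * ratr q) else set0.
suff -> : ruin_event t u = random_sum_gt t (u + c * t) `|` \bigcup_q F q.
  apply: measurableU; first exact: measurable_random_sum_gt.
  apply: bigcupT_measurable_rat => q; rewrite /F; case: ifP => // _.
  exact: measurable_random_sum_gt.
apply/seteqP; split => w.
  move=> [s /andP[s0 st]]; rewrite risk_lt0 => sw.
  move: st; rewrite le_eqVlt => /predU1P[st|st]; first by left; rewrite -st.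
  right; have [e e0 He] := time_changed_right_constant D
    (poisson_cadlag hN w) (poisson_nd hN w) s.
  (* The time the premium needs to make up the deficit at [s]. Until [s + e] no claim arrives, so
     ruin persists at every time before both [s + e] and [s + dl]. *)
  pose dl := (partial_sum X (M s w) w - (u + c * s)) / c.
  have dl0 : 0 < dl by rewrite divr_gt0// subr_gt0.
  pose b := Num.min t (Num.min (s + e) (s + dl)).
  have sb : s < b by rewrite /b !lt_min st !ltrDl e0 dl0.
  have [q] := rat_in_itvoo sb; rewrite in_itv/= /b !lt_min => /and4P[sq qt qe qd].
  exists q => //; rewrite /F (le_trans s0 (ltW sq)) (ltW qt)/= /random_sum_gt/=.
  rewrite /M He ?(ltW sq)// -/M.
  have : c * ratr q < c * (s + dl) by rewrite ltr_pM2l.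
  rewrite mulrDr /dl [c * (_ / c)]mulrC divfK ?gt_eqF//; lra.
move=> [H|[q _]]; first by exists t; rewrite ?t0 ?lexx// risk_lt0.
rewrite /F; case: ifP => // qt H; exists (ratr q) => //.
by rewrite risk_lt0.
Qed.

Lemma ruin_lower t u : 0 <= t ->
  (P (random_sum_gt t (u + c * t)%R) <= P (ruin_event t u))%E.
Proof.
move=> t0; rewrite le_measure ?inE//.
- exact: measurable_random_sum_gt.
- exact: measurable_ruin_event.
by move=> w H; exists t; rewrite ?t0 ?lexx// risk_lt0.
Qed.

Lemma ruin_upper t u : 0 <= t -> (P (ruin_event t u) <= P (random_sum_gt t u))%E.
Proof.
(* Outside the null events [Z1] and [Z2], the count is at most its value at [t] and the partial sums
   are nondecreasing; dropping the premium [c * s >= 0] then gives the inclusion. *)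
move=> t0; pose Z1 := [set w | forall n : nat, D n%:R w <= t].
pose Z2 := ~` \bigcap_i [set w | 0 < X i w].
have mZ1 : measurable Z1 := measurable_never_crossing (mixed_stable_measurable hD) t.
have mZ2 : measurable Z2 by apply/measurableC; exact: measurable_all_pos.
have PZ1 : P Z1 = 0%E by exact: (mixed_stable_never_crossing hC hD).
have PZ2 : P Z2 = 0%E by exact: all_pos_ae.
have mS := measurable_random_sum_gt t u.
apply: (@le_trans _ _ (P (random_sum_gt t u `|` (Z1 `|` Z2)))); last first.
  apply: le_trans (measureU2 _ mS (measurableU _ _ mZ1 mZ2)) _.
  rewrite -[leRHS]adde0; apply: leeD => //.
  apply: (@le_trans _ _ (P Z1 + P Z2)%E); first exact: measureU2.
  by rewrite PZ1 PZ2 adde0.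
rewrite le_measure ?inE//.
- exact: measurable_ruin_event.
- by apply: measurableU => //; exact: measurableU.
move=> w [s /andP[s0 st]]; rewrite risk_lt0 => sw.
have [X0|] := pselect ((\bigcap_i [set w | 0 < X i w]) w); last by right; right.
have [ex|out] := crosses_or_out D w t; last by right; left=> n; exact: out.
left; rewrite /random_sum_gt/=.
have MM : (M s w <= M t w)%N.
  apply: (poisson_nd hN); first exact: (inverse_process_ge0 D w s).
  exact: inverse_process_nd.
have SS : partial_sum X (M s w) w <= partial_sum X (M t w) w.
  rewrite !partial_sumE -(subnKC MM) big_split_ord/= lerDl sumr_ge0// => i _.
  by apply/ltW; exact: X0.
apply: lt_le_trans SS; apply: le_lt_trans sw.
by rewrite lerDl mulr_ge0// ltW.
Qed.

End ruin_event.

Lemma cvg_pinfty_shift {R : realType} (f : R -> R) (l y : R) :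
  f x @[x --> +oo] --> l -> f (y + x) @[x --> +oo] --> l.
Proof. by move=> fl; apply: cvg_comp fl; exact: cvg_addrl. Qed.

Theorem mainTheorem10 (R : realType) (d : measure_display)
    (T : measurableType d) (P : probability T R)
    (a1 a2 lambda C1 C2 c : R)
    (ha2 : 0 < a2) (ha21 : a2 < a1) (ha1 : a1 < 1)
    (hlambda : 0 < lambda)
    (hC1 : 0 <= C1) (hC2 : 0 <= C2) (hC : C1 + C2 = 1) (hc : 0 < c)
    (D : R -> T -> R) (hD : mixed_stable_subordinator P a1 a2 C1 C2 D)
    (N : R -> T -> nat) (hN : poisson_process P lambda N)
    (hND : independent_classes P
      (sigma_generated [set t | 0 <= t] N)
      (sigma_generated [set t | 0 <= t] (inverse_process D)))
    (X : nat -> {RV P >-> R}) (hXpos : forall i, P [set w | 0 < X i w] = 1%E)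
    (hXiid : iid P X)
    (hXsub : subexponential (distribution P (X 0%N)))
    (hXM : independent_classes P
      (sigma_generated setT X)
      (sigma_generated [set t | 0 <= t] (time_changed N D)))
    (t : R) (ht : 0 < t) :
  fine (ruin_probability P c (time_changed N D) X t u)
    / (lambda * fine ('E_P[inverse_process D t])%E
       * fine (P [set w | u < X 0%N w]))
  @[u --> +oo] --> (1 : R).
Proof.
have t0 : 0 <= t := ltW ht.
pose mu : probability R R := distribution P (X 0%N).
pose nu n : probability R R := distribution P (partial_sum X n).
pose W x := fine (P (random_sum_gt D N X t x)).
have mu_pos : mu `]0, +oo[%classic = 1%E := claim_law_pos hXpos.
have tE u : fine (P [set w | u < X 0%N w]) = tail mu u.
  by rewrite -tail_distributionE.
have tgt0 x : 0 < tail mu x := subexponential_tail_gt0 hXsub x.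
rewrite unlock.
have EY0 := inverse_process_expectation_gt0 hC hD ht.
have EYoo := inverse_process_expectation_lty hC hD ht.
pose m := lambda * fine (\int[P]_w (inverse_process D t w)%:E)%E.
have m0 : 0 < m by rewrite /m mulr_gt0// fine_gt0// EY0.
have mM k : measurable [set w | time_changed N D t w = k].
  exact: (measurable_time_changed (mixed_stable_measurable hD) (mixed_stable_nd hD)
    (poisson_measurable hN) (poisson_cadlag hN) (poisson_nd hN)).
have pE k : (fine (P [set w | time_changed N D t w = k]))%:E
    = P [set w | time_changed N D t w = k].
  by rewrite fineK// fin_num_measure.
have cW : W x / tail mu x @[x --> +oo] --> m.
  apply: (@subexponential_mixture _ mu mu_pos hXsub nu
    (partial_sum_law0 X) (partial_sum_lawS hXiid.1 hXiid.2 hXpos)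
    (fun k => fine (P [set w | time_changed N D t w = k])) W (1 + (2 * lambda)^-1)).
  - by rewrite ltrDl invr_gt0 mulr_gt0.
  - by move=> k; exact: fine_ge0.
  - under eq_eseriesr do rewrite EFinM pE muleC.
    exact: (time_changed_exp_moment hlambda hC hD hN hND ht).
  - under eq_eseriesr do rewrite EFinM pE muleC.
    rewrite -(integral_nat_valued P (h := time_changed N D t) (f := fun k => k%:R))//.
    rewrite (time_changed_mean hlambda hD hN hND ht) /m EFinM fineK//.
    by rewrite ge0_fin_numE// ltW.
  - move=> x x0; rewrite -(random_sum_gt_series hD hN hXM)//.
    by rewrite fineK// fin_num_measure//; exact: (measurable_random_sum_gt hD hN).
have ct0 : 0 <= c * t by rewrite mulr_ge0// ltW.
have cWl : W (c * t + x) / tail mu x @[x --> +oo] --> m.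
  (* Both limits are read at [c * t + x]. The second concerns [tail mu x / tail mu (c * t + x)], and
     its inverse replaces the shifted tail in the first by [tail mu x]. *)
  have H1 := cvg_pinfty_shift (c * t) cW.
  have H2 := cvg_pinfty_shift (c * t) (subexponential_long_tailed mu_pos hXsub ct0).
  rewrite -[m]divr1.
  apply: cvg_trans (cvgM H1 (cvgV (oner_neq0 _) H2)); apply: near_eq_cvg; near=> x.
  rewrite [LHS](_ : _ = W (c * t + x) / tail mu (c * t + x)
    * (tail mu (c * t + x - c * t) / tail mu (c * t + x))^-1)//.
  rewrite [c * t + x - _]addrAC subrr add0r.
  by field; rewrite !(gt_eqF (tgt0 _)).
apply: (@squeeze_cvgr _ _ _ _ (fun u => W (c * t + u) / tail mu u / m)
  (fun u => W u / tail mu u / m)); last 2 first.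
- rewrite -[X in _ --> X](@divff _ m) ?gt_eqF//.
  by apply: cvgM => //; exact: cvg_cst.
- rewrite -[X in _ --> X](@divff _ m) ?gt_eqF//.
  by apply: cvgM => //; exact: cvg_cst.
near=> u.
rewrite tE -/m.
have fP A : measurable A -> P A \is a fin_num by move=> mA; exact: fin_num_measure.
have mR := measurable_ruin_event hc hD hN X u t0.
have mS := measurable_random_sum_gt hD hN X t.
have E z : z / tail mu u / m = z / (m * tail mu u).
  by rewrite -mulrA -invfM mulrC [tail _ _ * _]mulrC mulrC.
have mt0 : 0 < (m * tail mu u)^-1 by rewrite invr_gt0 (mulr_gt0 m0).
rewrite !E !(ler_pM2r mt0).
apply/andP; split; rewrite /W; apply: fine_le; rewrite ?fP//.
  by rewrite [c * t + u]addrC; exact: (ruin_lower hc hD hN).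
exact: (ruin_upper hC hc hD hN hXpos).
Unshelve. all: by end_near. Qed.
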